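(* Let $\alpha,\beta\in\mathbb{C}$, $p\in\mathbb{C}^*$, and let $V$ be a non-trivial conformal module over $\mathfrak{B}(\alpha,\beta,p)$ that is free of rank one over $\mathbb{C}[\partial]$. (1) Suppose $p\neq-1$. (i) If $(\alpha,\beta)\neq(p,0)$, then $V\cong V_{a,b}$ for some $a,b\in\mathbb{C}$. (ii) If $(\alpha,\beta)=(p,0)$, then $V\cong V_{a,b,d}$ for some $a,b,d\in\mathbb{C}$. (2) Suppose $p=-1$. (iii) If $(\alpha,\beta)\neq(-1,0)$, then $V\cong V_{a,b,c}$ for some $a,b,c\in\mathbb{C}$. (iv) If $(\alpha,\beta)=(-1,0)$, then $V\cong V_{a,b,c,d}$ for some $a,b,c,d\in\mathbb{C}$.
   Context: All vector spaces are over $\mathbb{C}$; $\mathbb{C}^*=\mathbb{C}\setminus\{0\}$, $\mathbb{Z}_+=\{0,1,2,\dots\}$. A Lie conformal algebra is a $\mathbb{C}[\partial]$-module $R$ with a linear map $R\otimes R\to R[\lambda]=\mathbb{C}[\lambda]\otimes R$, $a\otimes b\mapsto[a\,{}_\lambda\,b]$, such that $[\partial a\,{}_\lambda\,b]=-\lambda[a\,{}_\lambda\,b]$, $[a\,{}_\lambda\,\partial b]=(\partial+\lambda)[a\,{}_\lambda\,b]$, $[a\,{}_\lambda\,b]=-[b\,{}_{-\lambda-\partial}\,a]$, and $[a\,{}_\lambda[b\,{}_\mu\,c]]=[[a\,{}_\lambda\,b]\,{}_{\lambda+\mu}\,c]+[b\,{}_\mu[a\,{}_\lambda\,c]]$.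 A conformal module over $R$ is a $\mathbb{C}[\partial]$-module $M$ with a linear map $R\otimes M\to M[\lambda]$, $a\otimes v\mapsto a\,{}_\lambda\,v$, such that $(\partial a)\,{}_\lambda\,v=-\lambda\, a\,{}_\lambda\,v$, $a\,{}_\lambda(\partial v)=(\partial+\lambda)\,a\,{}_\lambda\,v$, $a\,{}_\lambda(b\,{}_\mu\,v)-b\,{}_\mu(a\,{}_\lambda\,v)=[a\,{}_\lambda\,b]\,{}_{\lambda+\mu}\,v$. It is non-trivial if the $\lambda$-action is not identically zero. For $\alpha,\beta\in\mathbb{C}$, $p\in\mathbb{C}^*$, $\mathfrak{B}(\alpha,\beta,p)$ is the Lie conformal algebra that is free over $\mathbb{C}[\partial]$ with basis $\{L_i,W_i\mid i\in\mathbb{Z}_+\}$ and $\lambda$-brackets $[L_i\,{}_\lambda\,L_j]=\big((i+p)\partial+(i+j+2p)\lambda\big)L_{i+j}$, $[L_i\,{}_\lambda\,W_j]=\big((i+p)(\partial+\beta)+(i+j+\alpha)\lambda\big)W_{i+j}$, $[W_i\,{}_\lambda\,W_j]=0$ (with $[W_j\,{}_\lambda\,L_i]$ given by skew-symmetry). The following are conformal modules over $\mathfrak{B}(\alpha,\beta,p)$, each free of rank one over $\mathbb{C}[\partial]$ with generator $v$: - If $(\alpha,\beta)\neq(p,0)$, $a,b\in\mathbb{C}$: $V_{a,b}=\mathbb{C}[\partial]v$ with $L_0\,{}_\lambda\,v=p(\partial+a\lambda+b)v$, $W_0\,{}_\lambda\,v=0$, $L_i\,{}_\lambda\,v=W_i\,{}_\lambda\,v=0$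 for $i\ge1$. - If $(\alpha,\beta)=(p,0)$, $a,b,d\in\mathbb{C}$: $V_{a,b,d}=\mathbb{C}[\partial]v$ with $L_0\,{}_\lambda\,v=p(\partial+a\lambda+b)v$, $W_0\,{}_\lambda\,v=dv$, $L_i\,{}_\lambda\,v=W_i\,{}_\lambda\,v=0$ for $i\ge1$. - If $p=-1$ and $(\alpha,\beta)\neq(-1,0)$, $a,b,c\in\mathbb{C}$: $V_{a,b,c}=\mathbb{C}[\partial]v$ with $L_0\,{}_\lambda\,v=-(\partial+a\lambda+b)v$, $L_1\,{}_\lambda\,v=cv$, $L_j\,{}_\lambda\,v=0$ for $j\ge2$, $W_i\,{}_\lambda\,v=0$ for all $i\ge0$. - If $p=-1$ and $(\alpha,\beta)=(-1,0)$, $a,b,c,d\in\mathbb{C}$: $V_{a,b,c,d}=\mathbb{C}[\partial]v$ with $L_0\,{}_\lambda\,v=-(\partial+a\lambda+b)v$, $L_1\,{}_\lambda\,v=cv$, $L_j\,{}_\lambda\,v=0$ for $j\ge2$, $W_0\,{}_\lambda\,v=dv$, $W_i\,{}_\lambda\,v=0$ for $i\ge1$. *)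

(* Defs.v *)
From HB Require Import structures.
From mathcomp Require Import all_boot all_order all_algebra.
From mathcomp Require Import finmap monalg.
From mathcomp Require Import reals complex ring.

Set Implicit Arguments.
Unset Strict Implicit.
Unset Printing Implicit Defensive.

Import GRing.Theory.
Local Open Scope ring_scope.

(* M[λ]: finitely supported sequences of coefficients in M.  It is a module
   over S[λ], so that M[λ][μ] = lpoly (lpoly M) is a module over S[λ][μ]. *)
Definition lpoly (S : comNzRingType) (M : lmodType S) : Type := {malg M[nat]}.

HB.instance Definition _ (S : comNzRingType) (M : lmodType S) :=
  GRing.Zmodule.copy (lpoly M) {malg M[nat]}.

Section LPoly.
Variables (S : comNzRingType) (M : lmodType S).
Implicit Types (c d : {poly S}) (f g : lpoly M).

Definition lcoef f (n : nat) : M := mcoeff n f.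

Definition lconst (m : M) : lpoly M := << m *g 0%N >>.

Definition lscale c f : lpoly M :=
  \sum_(i < size c) \sum_(j <- msupp f) << c`_i *: lcoef f j *g (i + j)%N >>.

Lemma lpolyP f g : (forall n, lcoef f n = lcoef g n) -> f = g.
Proof. by move/malgP. Qed.

Lemma lcoefD f g n : lcoef (f + g) n = lcoef f n + lcoef g n.
Proof. exact: mcoeffD. Qed.

Lemma lcoef_sum (I : Type) (r : seq I) (P : pred I) (F : I -> lpoly M) n :
  lcoef (\sum_(i <- r | P i) F i) n = \sum_(i <- r | P i) lcoef (F i) n.
Proof. exact: (raddf_sum (mcoeff n)). Qed.

Lemma lcoefU m k n : lcoef << m *g k >> n = m *+ (k == n).
Proof. exact: mcoeffU. Qed.

Lemma lscaleE c f n :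
  lcoef (lscale c f) n = \sum_(i < n.+1) c`_i *: lcoef f (n - i).
Proof.
rewrite lcoef_sum.
pose G i := if (i <= n)%N then c`_i *: lcoef f (n - i) else 0.
transitivity (\sum_(i < size c) G i).
  apply: eq_bigr => i _; rewrite lcoef_sum /G.
  case: leqP => [lein | ltni]; last first.
    rewrite big1_seq // => j _; rewrite lcoefU gtn_eqF ?mulr0n //.
    exact: ltn_addr.
  have [inS | ninS] := boolP ((n - i)%N \in msupp f).
    rewrite (big_fsetD1 _ inS) /= lcoefU subnKC // eqxx mulr1n.
    rewrite big1_fset ?addr0 // => j; rewrite in_fsetD1 => /andP[jn _] _.
    rewrite lcoefU; case: eqP => // E; case/eqP: jn.
    by rewrite -E addKn.
  rewrite [lcoef f _]mcoeff_outdom // scaler0 big1_fset // => j jf _.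
  rewrite lcoefU; case: eqP => // E; case/negP: ninS.
  by rewrite -E addKn.
pose N := maxn (size c) n.+1.
have E1 : \sum_(i < size c) G i = \sum_(i < N) G i.
  rewrite (big_ord_widen N G) ?leq_maxl // big_mkcond /=; apply: eq_bigr => i _.
  by case: ltnP => // le; rewrite /G nth_default // scale0r if_same.
rewrite E1 (big_ord_widen N (fun i => c`_i *: lcoef f (n - i))) ?leq_maxr //.
by rewrite [RHS]big_mkcond /=; apply: eq_bigr => i _; rewrite ltnS.
Qed.

Lemma lscaleE_rev c f n :
  lcoef (lscale c f) n = \sum_(i < n.+1) c`_(n - i) *: lcoef f i.
Proof.
rewrite lscaleE (reindex_inj rev_ord_inj) /=.
by apply: eq_bigr => i _; rewrite subSS subKn // -ltnS.
Qed.

Lemma lscaleA c d f : lscale c (lscale d f) = lscale (c * d) f.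
Proof.
apply: lpolyP => n; rewrite lscaleE lscaleE_rev.
pose coef3 j k := c`_j *: (d`_(n - j - k) *: lcoef f k).
transitivity (\sum_(j < n.+1) \sum_(k < n.+1 | (k <= n - j)%N) coef3 j k).
  apply: eq_bigr => /= j _; rewrite lscaleE_rev scaler_sumr.
  by rewrite (big_ord_narrow_leq (leq_subr _ _)).
rewrite (exchange_big_dep predT) //=; apply: eq_bigr => k _.
transitivity (\sum_(j < n.+1 | (j <= n - k)%N) coef3 j k).
  apply: eq_bigl => j; rewrite -ltnS -(ltnS j) -!subSn ?leq_ord //.
  by rewrite -subn_gt0 -(subn_gt0 j) -!subnDA addnC.
rewrite (big_ord_narrow_leq (leq_subr _ _)) coefM scaler_suml.
by apply: eq_bigr => i _; rewrite /coef3 scalerA /= -!subnDA addnC.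
Qed.

Lemma lscale1 f : lscale 1 f = f.
Proof.
apply: lpolyP => n; rewrite lscaleE big_ord_recl coef1 /= scale1r subn0.
by rewrite big1 ?addr0 // => i _; rewrite coef1 /= scale0r.
Qed.

Lemma lscaleDr c f g : lscale c (f + g) = lscale c f + lscale c g.
Proof.
apply: lpolyP => n; rewrite lcoefD !lscaleE -big_split.
by apply: eq_bigr => i _; rewrite lcoefD scalerDr.
Qed.

Lemma lscaleDl f c d : lscale (c + d) f = lscale c f + lscale d f.
Proof.
apply: lpolyP => n; rewrite lcoefD !lscaleE -big_split.
by apply: eq_bigr => i _; rewrite coefD scalerDl.
Qed.

HB.instance Definition _ := GRing.Zmodule_isLmodule.Build {poly S} (lpoly M)
  lscaleA lscale1 lscaleDr lscaleDl.

Lemma lcoefZ c f n :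
  lcoef (c *: f) n = \sum_(i < n.+1) c`_i *: lcoef f (n - i).
Proof. exact: lscaleE. Qed.

Lemma lconstD m1 m2 : lconst (m1 + m2) = lconst m1 + lconst m2.
Proof. exact: monalgUD. Qed.

Lemma lcoef_const m n : lcoef (lconst m) n = m *+ (0%N == n).
Proof. exact: lcoefU. Qed.

Lemma lconstZ (s : S) m : lconst (s *: m) = s%:P *: lconst m.
Proof.
apply: lpolyP => n; rewrite lcoefZ big_ord_recl big1 => [|i _].
  by rewrite subn0 addr0 !lcoef_const coefC eqxx scalerMnr.
by rewrite coefC /= scale0r.
Qed.

Lemma lmonoZ m k : << m *g k >> = 'X^k *: lconst m :> lpoly M.
Proof.
apply: lpolyP => n; rewrite lcoefZ lcoefU; case: eqP => [<-|ne].
  rewrite big_ord_recr /= coefXn eqxx scale1r subnn lcoef_const eqxx big1 ?add0r //.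
  by move=> i _; rewrite coefXn ltn_eqF ?scale0r.
rewrite big1 // => i _; rewrite coefXn lcoef_const.
case: eqP => [e|]; last by rewrite scale0r.
case: eqP => [e'|]; last by rewrite scaler0.
by case: ne; rewrite -e; apply/eqP; rewrite eqn_leq -ltnS ltn_ord -subn_eq0 -e'.
Qed.

Lemma lpolyE f : f = \sum_(k <- msupp f) 'X^k *: lconst (lcoef f k).
Proof. by rewrite {1}[f]monalgE; apply: eq_bigr => k _; rewrite -lmonoZ. Qed.

End LPoly.

Definition evm (S T : comNzRingType) (sigma : {rmorphism S -> T}) (q : T) :
  {poly S} -> T := horner_morph (fun x => mulrC q (sigma x)).

HB.instance Definition _ S T sigma q := GRing.RMorphism.on (@evm S T sigma q).

Section Evm.
Variables (S T : comNzRingType) (sigma : {rmorphism S -> T}) (q : T).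

Lemma evmE c : evm sigma q c = (map_poly sigma c).[q].
Proof. by []. Qed.

Lemma evmX : evm sigma q 'X = q.
Proof. exact: horner_morphX. Qed.

Lemma evmC s : evm sigma q s%:P = sigma s.
Proof. exact: horner_morphC. Qed.

Lemma poly_morph_ext (f g : {rmorphism {poly S} -> T}) :
  f 'X = g 'X -> (forall s, f s%:P = g s%:P) -> f =1 g.
Proof.
move=> fgX fgC; elim/poly_ind => [|c s IH]; first by rewrite !rmorph0.
by rewrite !rmorphD !rmorphM IH fgX fgC.
Qed.

End Evm.

(* f(q) := Σ_k q^k h(f_k): the indeterminate of f is replaced by the scalar q,
   and the coefficients of f are sent to N by h. *)
Definition lsubst (S T : comNzRingType) (M : lmodType S) (N : lmodType T)
    (h : M -> N) (q : T) (f : lpoly M) : N :=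
  \sum_(k <- msupp f) q ^+ k *: h (lcoef f k).

Section LSubst.
Variables (S T : comNzRingType) (M : lmodType S) (N : lmodType T).
Variables (h : M -> N) (q : T).
Hypothesis hD : forall m1 m2, h (m1 + m2) = h m1 + h m2.

Let h0 : h 0 = 0.
Proof. by apply: (addrI (h 0)); rewrite -hD !addr0. Qed.

Lemma lsubstEw f (D : {fset nat}) : (msupp f `<=` D)%fset ->
  lsubst h q f = \sum_(k <- D) q ^+ k *: h (lcoef f k).
Proof.
move=> le; rewrite /lsubst; apply: big_fset_incl => //= k _ kf.
by rewrite [lcoef _ _]mcoeff_outdom // h0 scaler0.
Qed.

Lemma lsubstD f g : lsubst h q (f + g) = lsubst h q f + lsubst h q g.
Proof.
rewrite (@lsubstEw f (msupp f `|` msupp g)%fset) ?fsubsetUl //.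
rewrite (@lsubstEw g (msupp f `|` msupp g)%fset) ?fsubsetUr //.
rewrite (@lsubstEw (f + g) (msupp f `|` msupp g)%fset) ?msuppD_le //.
by rewrite -big_split; apply: eq_bigr => k _; rewrite lcoefD hD scalerDr.
Qed.

Lemma lsubst0 : lsubst h q 0 = 0.
Proof. by rewrite /lsubst msupp0 big_seq_fset0. Qed.

Lemma lsubst_sum (I : Type) (r : seq I) (P : pred I) (F : I -> lpoly M) :
  lsubst h q (\sum_(i <- r | P i) F i) = \sum_(i <- r | P i) lsubst h q (F i).
Proof. exact: (big_morph _ lsubstD lsubst0). Qed.

Lemma lsubstXn m k : lsubst h q ('X^k *: lconst m) = q ^+ k *: h m.
Proof.
rewrite -lmonoZ (@lsubstEw _ [fset k]%fset) ?msuppU_le //.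
by rewrite big_seq_fset1 lcoefU eqxx.
Qed.

Lemma lsubst_const m : lsubst h q (lconst m) = h m.
Proof. by rewrite -[lconst m]scale1r -(expr0 'X) lsubstXn expr0 scale1r. Qed.

Variable sigma : {rmorphism S -> T}.
Hypothesis hZ : forall s m, h (s *: m) = sigma s *: h m.

Lemma lsubst_mulX f : lsubst h q ('X *: f) = q *: lsubst h q f.
Proof.
rewrite [f]lpolyE scaler_sumr !lsubst_sum scaler_sumr; apply: eq_bigr => k _.
by rewrite scalerA -exprS !lsubstXn scalerA -exprS.
Qed.

Lemma lsubst_mulC s f : lsubst h q (s%:P *: f) = sigma s *: lsubst h q f.
Proof.
rewrite [f]lpolyE scaler_sumr !lsubst_sum scaler_sumr; apply: eq_bigr => k _.
by rewrite scalerA mulrC -scalerA -lconstZ !lsubstXn hZ !scalerA mulrC.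
Qed.

Lemma lsubstZ c f : lsubst h q (c *: f) = evm sigma q c *: lsubst h q f.
Proof.
rewrite evmE.
elim/poly_ind: c => [|c s IH].
  by rewrite rmorph0 horner0 !scale0r lsubst0.
rewrite scalerDl lsubstD [c * 'X]mulrC -scalerA lsubst_mulX lsubst_mulC IH.
rewrite mulrC rmorphD rmorphM /= map_polyX map_polyC /= hornerMXaddC.
by rewrite scalerA scalerDl mulrC.
Qed.

End LSubst.

(* In K[∂][λ], the outer indeterminate is λ. *)
Notation del := ('X%:P : {poly {poly _}}).
Notation lam := ('X : {poly {poly _}}).

Record sesquilinear (K : fieldType) (A M : lmodType {poly K})
    (act : A -> M -> lpoly M) : Prop := Sesquilinear {
  sesq_addl : forall a1 a2 v, act (a1 + a2) v = act a1 v + act a2 v;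
  sesq_addr : forall a v1 v2, act a (v1 + v2) = act a v1 + act a v2;
  sesq_scalel : forall (z : K) a v, act (z%:P *: a) v = z%:P%:P *: act a v;
  sesq_scaler : forall (z : K) a v, act a (z%:P *: v) = z%:P%:P *: act a v;
  sesq_dl : forall a v, act ('X *: a) v = - lam *: act a v;
  sesq_dr : forall a v, act a ('X *: v) = (del + lam) *: act a v
}.

Definition lconst2 (K : fieldType) (M : lmodType {poly K}) (m : M) :
  lpoly (lpoly M) := lconst (lconst m).

(* In K[∂][λ][μ] the outer indeterminate is μ, so λ is 'X%:P and ∂ is
   'X%:P%:P.  The identity, in M[λ][μ], is
   a_λ(b_μ v) - b_μ(a_λ v) = [a_λ b]_{λ+μ} v; it serves both for modules and,
   with the adjoint action, for the algebra itself. *)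
Definition conformal_jacobi (K : fieldType) (A M : lmodType {poly K})
    (br : A -> A -> lpoly A) (act : A -> M -> lpoly M) (a b : A) (v : M) : Prop :=
  let la : {poly {poly {poly K}}} := 'X%:P in
  let mu : {poly {poly {poly K}}} := 'X in
  lsubst (fun w => lsubst (@lconst2 K M) la (act a w)) mu (act b v)
  - lsubst (fun w => lsubst (@lconst2 K M) mu (act b w)) la (act a v)
  = lsubst (fun c => lsubst (@lconst2 K M) (la + mu) (act c v)) la (br a b).

Record lieConformalAlgebra (K : fieldType) := LieConformalAlgebra {
  lca_sort :> lmodType {poly K};
  bracket : lca_sort -> lca_sort -> lpoly lca_sort;
  bracket_sesq : sesquilinear bracket;
  bracket_skew : forall a b,
    bracket a b = - lsubst (@lconst _ lca_sort) (- lam - del) (bracket b a);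
  bracket_jacobi : forall a b c, conformal_jacobi bracket bracket a b c
}.

Record conformalModule (K : fieldType) (A : lieConformalAlgebra K) :=
  ConformalModule {
  cm_sort :> lmodType {poly K};
  act : A -> cm_sort -> lpoly cm_sort;
  act_sesq : sesquilinear act;
  act_jacobi : forall a b v, conformal_jacobi (@bracket K A) act a b v
}.

Definition nontrivial_module (K : fieldType) (A : lieConformalAlgebra K)
    (V : conformalModule A) : Prop :=
  exists a : A, exists v : V, act a v <> 0.

Definition free_rank_one (K : fieldType) (A : lieConformalAlgebra K)
    (V : conformalModule A) : Prop :=
  exists v : V, bijective (fun P : {poly K} => P *: v).

Definition module_iso (K : fieldType) (A : lieConformalAlgebra K)
    (V W : conformalModule A) : Prop :=
  exists f : {linear V -> W}, bijective f /\
    forall (a : A) (v : V) (n : nat), lcoef (act a (f v)) n = f (lcoef (act a v) n).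


Section Theory.
Variable K : fieldType.
Notation P1 := {poly K}.
Notation P2 := {poly {poly K}}.
Notation P3 := {poly {poly {poly K}}}.

Definition CC2 : {rmorphism K -> P2} := (polyC \o polyC : {rmorphism K -> P2}).
Definition CC3 : {rmorphism P1 -> P3} := (polyC \o polyC : {rmorphism P1 -> P3}).

(* P(∂) ↦ P(-λ) and P(∂) ↦ P(∂+λ). *)
Definition dsubl : {rmorphism P1 -> P2} := evm CC2 (- lam).
Definition dsubr : {rmorphism P1 -> P2} := evm CC2 (del + lam).

Lemma dsublX : dsubl 'X = - lam. Proof. exact: evmX. Qed.
Lemma dsublC z : dsubl z%:P = z%:P%:P. Proof. exact: evmC. Qed.
Lemma dsubrX : dsubr 'X = del + lam. Proof. exact: evmX. Qed.
Lemma dsubrC z : dsubr z%:P = z%:P%:P. Proof. exact: evmC. Qed.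

Fact ev2_key : {f : P3 -> {rmorphism P2 -> P3} | f = fun q => evm CC3 q}.
Proof. by exists (fun q => evm CC3 q). Qed.
Definition ev2 := sval ev2_key.
Lemma ev2E : ev2 = fun q => evm CC3 q. Proof. exact: svalP ev2_key. Qed.

Fact ev3_key : {f : {rmorphism P1 -> P2} -> P3 -> P3 -> {rmorphism P2 -> P3} |
   f = fun s x y => evm (ev2 x \o s : {rmorphism P1 -> P3}) y}.
Proof. by eexists. Qed.
Definition ev3 := sval ev3_key.
Lemma ev3E : ev3 = fun s x y => evm (ev2 x \o s : {rmorphism P1 -> P3}) y.
Proof. exact: svalP ev3_key. Qed.

Lemma ev2X q : ev2 q 'X = q. Proof. by rewrite ev2E; exact: evmX. Qed.
Lemma ev2C q s : ev2 q s%:P = s%:P%:P. Proof. by rewrite ev2E; exact: evmC. Qed.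
Lemma ev3X s x y : ev3 s x y 'X = y. Proof. by rewrite ev3E; exact: evmX. Qed.
Lemma ev3C s x y z : ev3 s x y z%:P = ev2 x (s z).
Proof. by rewrite ev3E; exact: evmC. Qed.

Section Sesq.
Variables (dsubl dsubr : {rmorphism P1 -> P2}).
Hypothesis dsublX : dsubl 'X = - lam.
Hypothesis dsublC : forall z, dsubl z%:P = z%:P%:P.
Hypothesis dsubrX : dsubr 'X = del + lam.
Hypothesis dsubrC : forall z, dsubr z%:P = z%:P%:P.
Let evE := (dsublX, dsublC, dsubrX, dsubrC, ev2X, ev2C, ev3X, ev3C).

Variables (A M : lmodType P1) (br : A -> A -> lpoly A) (act : A -> M -> lpoly M).
Hypothesis sbr : sesquilinear br.
Hypothesis sact : sesquilinear act.

Lemma sesqZl (B : lmodType P1) (f : A -> B -> lpoly B) (sf : sesquilinear f)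
  P a v : f (P *: a) v = dsubl P *: f a v.
Proof.
elim/poly_ind: P => [|P z IH].
  have := sesq_scalel sf 0 a v; rewrite !scale0r rmorph0 scale0r => ->.
  by rewrite ?polyC0 ?scale0r.
rewrite scalerDl (sesq_addl sf) (sesq_scalel sf) mulrC -scalerA (sesq_dl sf) IH.
by rewrite scalerA -scalerDl rmorphD rmorphM /= dsublX dsublC.
Qed.

Lemma sesqZr (B : lmodType P1) (f : A -> B -> lpoly B) (sf : sesquilinear f)
  P a v : f a (P *: v) = dsubr P *: f a v.
Proof.
elim/poly_ind: P => [|P z IH].
  have := sesq_scaler sf 0 a v; rewrite !scale0r rmorph0 scale0r => ->.
  by rewrite ?polyC0 ?scale0r.
rewrite scalerDl (sesq_addr sf) (sesq_scaler sf) mulrC -scalerA (sesq_dr sf) IH.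
by rewrite scalerA -scalerDl rmorphD rmorphM /= dsubrX dsubrC.
Qed.

Lemma lconst2D (m1 m2 : M) : lconst2 (m1 + m2) = lconst2 m1 + lconst2 m2.
Proof. by rewrite /lconst2 !lconstD. Qed.

Lemma lconst2Z P (m : M) : lconst2 (P *: m) = CC3 P *: lconst2 m.
Proof. by rewrite /lconst2 !lconstZ. Qed.

Definition su q : lpoly M -> lpoly (lpoly M) := lsubst (@lconst2 K M) q.

Lemma suD q f g : su q (f + g) = su q f + su q g.
Proof. exact: lsubstD lconst2D _ _. Qed.

Lemma suZ q c f : su q (c *: f) = ev2 q c *: su q f.
Proof. by rewrite ev2E; exact: lsubstZ lconst2D _ lconst2Z _ _. Qed.

Definition jac2 x y a f := lsubst (fun w => su x (act a w)) y f.

Lemma jac2D x y a f g : jac2 x y a (f + g) = jac2 x y a f + jac2 x y a g.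
Proof. by apply: lsubstD => *; rewrite (sesq_addr sact) suD. Qed.

Lemma jac2Z x y a c f : jac2 x y a (c *: f) = ev3 dsubr x y c *: jac2 x y a f.
Proof.
rewrite ev3E; apply: lsubstZ => [*|P w] /=; first by rewrite (sesq_addr sact) suD.
by rewrite (sesqZr sact) suZ.
Qed.

Lemma jac2Dl x y a b f : jac2 x y (a + b) f = jac2 x y a f + jac2 x y b f.
Proof.
rewrite /jac2 /lsubst -big_split; apply: eq_bigr => k _.
by rewrite (sesq_addl sact) suD scalerDr.
Qed.

Lemma jac2Zl x y P a f : jac2 x y (P *: a) f = ev2 x (dsubl P) *: jac2 x y a f.
Proof.
rewrite /jac2 /lsubst scaler_sumr; apply: eq_bigr => k _.
by rewrite (sesqZl sact) suZ !scalerA mulrC.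
Qed.

Definition jac3 z x (v : M) f := lsubst (fun c => su z (act c v)) x f.

Lemma jac3D z x v f g : jac3 z x v (f + g) = jac3 z x v f + jac3 z x v g.
Proof. by apply: lsubstD => *; rewrite (sesq_addl sact) suD. Qed.

Lemma jac3Z z x v c f : jac3 z x v (c *: f) = ev3 dsubl z x c *: jac3 z x v f.
Proof.
rewrite ev3E; apply: lsubstZ => [*|P w] /=; first by rewrite (sesq_addl sact) suD.
by rewrite (sesqZl sact) suZ.
Qed.

Lemma jac3Dr z x v w f : jac3 z x (v + w) f = jac3 z x v f + jac3 z x w f.
Proof.
rewrite /jac3 /lsubst -big_split; apply: eq_bigr => k _.
by rewrite (sesq_addr sact) suD scalerDr.
Qed.

Lemma jac3Zr z x P v f : jac3 z x (P *: v) f = ev2 z (dsubr P) *: jac3 z x v f.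
Proof.
rewrite /jac3 /lsubst scaler_sumr; apply: eq_bigr => k _.
by rewrite (sesqZr sact) suZ !scalerA mulrC.
Qed.

Notation la := ('X%:P : P3).
Notation mu := ('X : P3).
Notation J := (conformal_jacobi br act).

Lemma JE a b v : J a b v <->
  jac2 la mu a (act b v) - jac2 mu la b (act a v) = jac3 (la + mu) la v (br a b).
Proof. by []. Qed.

Ltac morph_eq := apply: (@poly_morph_ext _ _ (_ \o _) (_ \o _)) => [|?] /=;
  rewrite !(evE, rmorphN, rmorphD) /= ?evE ?opprD ?addrK ?addrA //.

Lemma ev3_ll P : ev3 dsubr la mu (dsubl P) = ev2 mu (dsubl P).
Proof. by move: P; morph_eq. Qed.
Lemma ev3_lr P : ev3 dsubr mu la (dsubl P) = ev2 la (dsubl P).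
Proof. by move: P; morph_eq. Qed.
Lemma ev3_l3 P : ev3 dsubl (la + mu) la (dsubl P) = ev2 la (dsubl P).
Proof. by move: P; morph_eq. Qed.
Lemma ev3_r3 P : ev3 dsubl (la + mu) la (dsubr P) = ev2 mu (dsubl P).
Proof. by move: P; morph_eq; rewrite addrC addrA subrr add0r. Qed.
Lemma ev3_rl P : ev3 dsubr la mu (dsubr P) = ev2 (la + mu) (dsubr P).
Proof. by move: P; morph_eq. Qed.
Lemma ev3_rr P : ev3 dsubr mu la (dsubr P) = ev2 (la + mu) (dsubr P).
Proof. by move: P; morph_eq; rewrite addrAC. Qed.

Lemma JZ1 P a b v : J a b v -> J (P *: a) b v.
Proof.
rewrite !JE => E; rewrite (sesqZl sact) (sesqZl sbr) jac2Zl jac2Z jac3Z.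
by rewrite ev3_lr ev3_l3 -scalerBr E.
Qed.

Lemma JZ2 P a b v : J a b v -> J a (P *: b) v.
Proof.
rewrite !JE => E; rewrite (sesqZl sact) (sesqZr sbr) jac2Zl jac2Z jac3Z.
by rewrite ev3_ll ev3_r3 -scalerBr E.
Qed.

Lemma JZ3 P a b v : J a b v -> J a b (P *: v).
Proof.
rewrite !JE => E; rewrite !(sesqZr sact) !jac2Z jac3Zr.
by rewrite ev3_rl ev3_rr -scalerBr E.
Qed.

Lemma JD1 a1 a2 b v : J a1 b v -> J a2 b v -> J (a1 + a2) b v.
Proof.
rewrite !JE => E1 E2; rewrite (sesq_addl sact) (sesq_addl sbr) jac2Dl jac2D jac3D.
by rewrite -E1 -E2 opprD addrACA.
Qed.

Lemma JD2 a b1 b2 v : J a b1 v -> J a b2 v -> J a (b1 + b2) v.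
Proof.
rewrite !JE => E1 E2; rewrite (sesq_addl sact) (sesq_addr sbr) jac2Dl jac2D jac3D.
by rewrite -E1 -E2 opprD addrACA.
Qed.

Lemma JD3 a b v1 v2 : J a b v1 -> J a b v2 -> J a b (v1 + v2).
Proof.
rewrite !JE => E1 E2; rewrite !(sesq_addr sact) !jac2D jac3Dr.
by rewrite -E1 -E2 opprD addrACA.
Qed.

Definition spans (B : lmodType P1) (G : B -> Prop) := forall Q : B -> Prop,
  (forall x y, Q x -> Q y -> Q (x + y)) -> (forall c x, Q x -> Q (c *: x)) ->
  (forall g, G g -> Q g) -> forall x, Q x.

Lemma J_spans (GA : A -> Prop) (GM : M -> Prop) : spans GA -> spans GM ->
  (forall a b v, GA a -> GA b -> GM v -> J a b v) -> forall a b v, J a b v.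
Proof.
move=> sA sM H a b v.
elim/sA: a => [????|???|a ga]; [exact: JD1|exact: JZ1|].
elim/sA: b => [????|???|b gb]; [exact: JD2|exact: JZ2|].
elim/sM: v => [????|???|v gv]; [exact: JD3|exact: JZ3|exact: H].
Qed.

Lemma J_gen a b c v ca cb cab cba cc ccv (va vb w : M) :
  act b v = cb *: lconst vb -> act a vb = cab *: lconst w ->
  act a v = ca *: lconst va -> act b va = cba *: lconst w ->
  br a b = cc *: lconst c -> act c v = ccv *: lconst w ->
  ev3 dsubr la mu cb * ev2 la cab - ev3 dsubr mu la ca * ev2 mu cba =
    ev3 dsubl (la + mu) la cc * ev2 (la + mu) ccv ->
  J a b v.
Proof.
move=> E1 E2 E3 E4 E5 E6 E; rewrite JE E1 E3 E5 !jac2Z jac3Z /jac2 /jac3.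
rewrite !lsubst_const; last 3 first.
- by move=> *; rewrite (sesq_addl sact) suD.
- by move=> *; rewrite (sesq_addr sact) suD.
- by move=> *; rewrite (sesq_addr sact) suD.
rewrite E2 E4 E6 !suZ /su !(lsubst_const _ lconst2D) !scalerA -scalerBl.
by rewrite E.
Qed.

End Sesq.

Section Skew.
Variables (A : lmodType P1) (br : A -> A -> lpoly A).
Hypothesis sbr : sesquilinear br.

Definition Esk : {rmorphism P2 -> P2} :=
  evm (polyC : {rmorphism P1 -> P2}) (- lam - del).
Definition sk : lpoly A -> lpoly A := lsubst (@lconst _ A) (- lam - del).

Lemma EskX : Esk 'X = - lam - del. Proof. exact: evmX. Qed.
Lemma EskC P : Esk P%:P = P%:P. Proof. exact: evmC. Qed.

Lemma skD f g : sk (f + g) = sk f + sk g.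
Proof. exact: lsubstD (@lconstD _ _) _ _. Qed.

Lemma skZ c f : sk (c *: f) = Esk c *: sk f.
Proof. exact: lsubstZ (@lconstD _ _) _ (@lconstZ _ _) _ _. Qed.

Lemma sk_const a : sk (lconst a) = lconst a.
Proof. by rewrite /sk (lsubst_const _ (@lconstD _ _)). Qed.

Variables (s r e : {rmorphism P1 -> P2}) (E : {rmorphism P2 -> P2}).
Hypothesis sX : s 'X = - lam.
Hypothesis sC : forall z, s z%:P = z%:P%:P.
Hypothesis rX : r 'X = del + lam.
Hypothesis rC : forall z, r z%:P = z%:P%:P.
Hypothesis EX : E 'X = - lam - del.
Hypothesis EC : forall P, E P%:P = P%:P.
Hypothesis EZ : forall c f, sk (c *: f) = E c *: sk f.

Lemma Es P : E (s P) = r P.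
Proof.
move: P; apply: (@poly_morph_ext _ _ (E \o s) r) => [|z] /=.
  by rewrite sX rX rmorphN EX opprB opprK.
by rewrite sC rC EC.
Qed.

Lemma Er P : E (r P) = s P.
Proof.
move: P; apply: (@poly_morph_ext _ _ (E \o r) s) => [|z] /=.
  by rewrite sX rX rmorphD EX EC addrC subrK.
by rewrite sC rC EC.
Qed.

Lemma skew_spans (G : A -> Prop) : spans G ->
  (forall a b, G a -> G b -> br a b = - sk (br b a)) ->
  forall a b, br a b = - sk (br b a).
Proof.
move=> sp H a b.
elim/sp: a => [x y Hx Hy|P x Hx|a Ga].
- by rewrite (sesq_addl sbr) (sesq_addr sbr) skD opprD -Hx -Hy.
- by rewrite (sesqZl sX sC sbr) (sesqZr rX rC sbr) EZ Er Hx scalerN.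
elim/sp: b => [x y Hx Hy|P x Hx|b Gb].
- by rewrite (sesq_addl sbr) (sesq_addr sbr) skD opprD -Hx -Hy.
- by rewrite (sesqZl sX sC sbr) (sesqZr rX rC sbr) EZ Es Hx scalerN.
exact: H.
Qed.
End Skew.

Section Ext.
Variables (I : choiceType) (T : comNzRingType) (N : lmodType T).
Variables (sigma : {rmorphism P1 -> T}) (G : I -> N).

Definition semilin_ext (x : {malg {poly K}[I]}) : N :=
  \sum_(i <- msupp x) sigma x@_i *: G i.

Lemma semilin_extEw x (D : {fset I}) : (msupp x `<=` D)%fset ->
  semilin_ext x = \sum_(i <- D) sigma x@_i *: G i.
Proof.
move=> le; apply: big_fset_incl => //= k _ kf.
by rewrite mcoeff_outdom // rmorph0 scale0r.
Qed.

Lemma semilin_extD x y : semilin_ext (x + y) = semilin_ext x + semilin_ext y.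
Proof.
rewrite (@semilin_extEw x (msupp x `|` msupp y)%fset) ?fsubsetUl //.
rewrite (@semilin_extEw y (msupp x `|` msupp y)%fset) ?fsubsetUr //.
rewrite (@semilin_extEw (x + y) (msupp x `|` msupp y)%fset) ?msuppD_le //.
by rewrite -big_split; apply: eq_bigr => k _; rewrite mcoeffD rmorphD scalerDl.
Qed.

Lemma semilin_extZ P x : semilin_ext (P *: x) = sigma P *: semilin_ext x.
Proof.
rewrite (@semilin_extEw (P *: x) (msupp x)) ?msuppZ_le // scaler_sumr.
by apply: eq_bigr => k _; rewrite mcoeffZ rmorphM scalerA.
Qed.

Lemma semilin_extU i : semilin_ext << i >> = G i.
Proof.
rewrite (@semilin_extEw _ [fset i]%fset) ?msuppU_le // big_seq_fset1 mcoeffUU.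
by rewrite rmorph1 scale1r.
Qed.

Lemma malg_spans (i0 : I) :
  @spans {malg {poly K}[I]} (fun g => exists i, g = << i >>).
Proof.
move=> Q QD QZ QG x; rewrite [x]monalgE.
have QU i P : Q << P *g i >>.
  have -> : << P *g i >> = P *: << i >> :> {malg {poly K}[I]}.
    by apply/malgP => k; rewrite mcoeffZ !mcoeffU mulrnAr mulr1.
  by apply/QZ/QG; exists i.
by apply: (big_ind Q) => [|//|j _]; [rewrite -(@monalgU0 _ P1 i0)|].
Qed.

End Ext.

End Theory.

Section Concrete.
Variables (K : fieldType) (alpha beta p : K).

(* inl i stands for L_i and inr i for W_i. *)
Definition Bgen : Type := (nat + nat)%type.
HB.instance Definition _ := Choice.copy Bgen (nat + nat)%type.

(* The value on two W's is immaterial: its coefficient below is 0. *)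
Definition Bgen_add (s t : Bgen) : Bgen :=
  match s, t with
  | inl i, inl j => inl (i + j)%N
  | inl i, inr j | inr i, inl j => inr (i + j)%N
  | inr i, inr j => inr (i + j)%N
  end.

(* [s_λ t] = Bcoef s t · (s + t); the case of [W_j λ L_i] is the one forced by
   skew-symmetry. *)
Definition Bcoef (s t : Bgen) : {poly {poly K}} :=
  match s, t with
  | inl i, inl j =>
      (i%:R + p)%:P%:P * del + (i%:R + j%:R + p *+ 2)%:P%:P * lam
  | inl i, inr j =>
      (i%:R + p)%:P%:P * (del + beta%:P%:P) + (i%:R + j%:R + alpha)%:P%:P * lam
  | inr j, inl i =>
      - ((i%:R + p)%:P%:P * (del + beta%:P%:P)
         + (i%:R + j%:R + alpha)%:P%:P * (- lam - del))
  | inr _, inr _ => 0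
  end.

Definition Bcar : lmodType {poly K} := {malg {poly K}[Bgen]}.

Definition Bvec (s : Bgen) : Bcar := << s >>.

(* [P(∂)s_λ Q(∂)t] = P(-λ) Q(∂+λ) [s_λ t]. *)
Definition Bbracket (x y : Bcar) : lpoly Bcar :=
  semilin_ext (dsubl K) (fun s => semilin_ext (dsubr K) (fun t => Bcoef s t *: lconst (Bvec (Bgen_add s t))) y) x.

Lemma semilin_ext_sesq (I : choiceType) (M : lmodType {poly K}) (F : I -> M -> lpoly M) :
  (forall i v w, F i (v + w) = F i v + F i w) ->
  (forall i P v, F i (P *: v) = dsubr K P *: F i v) ->
  @sesquilinear K {malg {poly K}[I]} M (fun x v => semilin_ext (dsubl K) (F^~ v) x).
Proof.
move=> FD FZ; have FZ' x P v :
    semilin_ext (dsubl K) (F^~ (P *: v)) x = dsubr K P *: semilin_ext (dsubl K) (F^~ v) x.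
  rewrite /semilin_ext scaler_sumr; apply: eq_bigr => i _.
  by rewrite FZ !scalerA mulrC.
split=> [a1 a2 v|a v1 v2|z a v|z a v|a v|a v].
- exact: semilin_extD.
- by rewrite /semilin_ext -big_split; apply: eq_bigr => i _; rewrite FD scalerDr.
- by rewrite semilin_extZ dsublC.
- by rewrite FZ' dsubrC.
- by rewrite semilin_extZ dsublX.
- by rewrite FZ' dsubrX.
Qed.

Lemma Bbracket_sesq : sesquilinear Bbracket.
Proof. by apply: semilin_ext_sesq => [i v w|i P v]; [exact: semilin_extD|exact: semilin_extZ]. Qed.

Lemma BbracketU s t :
  Bbracket (Bvec s) (Bvec t) = Bcoef s t *: lconst (Bvec (Bgen_add s t)).
Proof. by rewrite /Bbracket !semilin_extU. Qed.

Lemma Bbracket_skew a b :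
  Bbracket a b = - lsubst (@lconst _ Bcar) (- lam - del) (Bbracket b a).
Proof.
apply: (@skew_spans K Bcar Bbracket Bbracket_sesq _ _ _ (@dsublX K) (@dsublC K)
  (@dsubrX K) (@dsubrC K) (@EskX K) (@EskC K) (@skZ K Bcar) _
  (malg_spans (inl 0%N : Bgen))).
move=> {a b} _ _ [s ->] [t ->].
rewrite !BbracketU skZ sk_const -scaleNr.
have -> : Bgen_add t s = Bgen_add s t by case: s t => i [] j /=; rewrite addnC.
congr (_ *: _).
have: Esk K 'X = - lam - del by exact: EskX.
have: forall P, Esk K P%:P = P%:P by exact: EskC.
move: (Esk K) => E EC EX.
case: s t => i [] j /=.
- rewrite !(rmorphD, rmorphM) /= !EX !EC.
  ring.
- rewrite !(rmorphN, rmorphD, rmorphM) /= !EX !EC.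
  ring.
- rewrite !(rmorphN, rmorphD, rmorphM) /= !EX !EC.
  ring.
- by rewrite rmorph0 oppr0.
Qed.

Notation la := ('X%:P : {poly {poly {poly K}}}).
Notation mu := ('X : {poly {poly {poly K}}}).

Definition gcE (T : comNzRingType) (i : K -> T) (D L : T) (s t : Bgen) : T :=
  match s, t with
  | inl j, inl k =>
      (j%:R + i p) * D + (j%:R + k%:R + i p *+ 2) * L
  | inl j, inr k =>
      (j%:R + i p) * (D + i beta) + (j%:R + k%:R + i alpha) * L
  | inr k, inl j =>
      - ((j%:R + i p) * (D + i beta) + (j%:R + k%:R + i alpha) * (- L - D))
  | inr _, inr _ => 0
  end.

Lemma gcEP (T : comNzRingType) (i : {rmorphism K -> T})
    (f : {rmorphism {poly {poly K}} -> T}) D L s t :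
  (forall z, f z%:P%:P = i z) -> f del = D -> f lam = L ->
  f (Bcoef s t) = gcE i D L s t.
Proof.
move=> fC fD fL; have i1 n : i n%:R = n%:R by rewrite rmorph_nat.
have i2 z : i (z *+ 2) = i z *+ 2 by rewrite rmorphMn.
by case: s t => j [] k /=; rewrite ?rmorph0 // !(rmorphN, rmorphD, rmorphM) /=
  ?(rmorphN, rmorphD) /= ?fC ?fD ?fL ?(rmorphD i) ?i1 ?i2.
Qed.

Lemma gcE_jacobi (T : comNzRingType) (i : K -> T) (d l m : T) s t u :
  gcE i (d + l) m t u * gcE i d l s (Bgen_add t u)
  - gcE i (d + m) l s u * gcE i d m t (Bgen_add s u)
  = gcE i (- (l + m)) l s t * gcE i d (l + m) (Bgen_add s t) u.
Proof.
case: s t u => j [] k [] n; rewrite /= ?(mul0r, mulr0, subr0, sub0r) //;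
  rewrite ?natrD; move: (i p) (i alpha) (i beta) => P A B; ring.
Qed.
Notation P2 := {poly {poly K}}.
Notation P3 := {poly {poly {poly K}}}.

Definition CCC : {rmorphism K -> P3} := (polyC \o polyC \o polyC : {rmorphism K -> P3}).


Section Eval.
Variables (h : {rmorphism {poly K} -> P2}).
Hypothesis hC : forall z, h z%:P = z%:P%:P.

Lemma ev2_Bcoef x s t : ev2 x (Bcoef s t) = gcE CCC 'X%:P%:P x s t.
Proof.
by apply: gcEP => [z||]; [exact: ev2C|exact: ev2C|exact: ev2X].
Qed.

Lemma ev3_Bcoef x y s t : ev3 h x y (Bcoef s t) = gcE CCC (ev2 x (h 'X)) y s t.
Proof.
apply: gcEP => [z||]; [|exact: ev3C|exact: ev3X].
by rewrite ev3C hC; exact: ev2C.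
Qed.
End Eval.

Lemma ev2sr x : ev2 x (dsubr K 'X) = 'X%:P%:P + x.
Proof. by rewrite dsubrX rmorphD /= ev2X ev2C. Qed.

Lemma ev2sl x : ev2 x (dsubl K 'X) = - x.
Proof. by rewrite dsublX rmorphN /= ev2X. Qed.

Lemma Bcoef_jacobi s t u :
  ev3 (dsubr K) la mu (Bcoef t u) * ev2 la (Bcoef s (Bgen_add t u))
  - ev3 (dsubr K) mu la (Bcoef s u) * ev2 mu (Bcoef t (Bgen_add s u))
  = ev3 (dsubl K) (la + mu) la (Bcoef s t) * ev2 (la + mu) (Bcoef (Bgen_add s t) u).
Proof.
rewrite !(ev3_Bcoef (@dsubrC K)) (ev3_Bcoef (@dsublC K)) !ev2_Bcoef !ev2sr ev2sl.
exact: gcE_jacobi.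
Qed.

Lemma Bbracket_jacobi a b c : conformal_jacobi Bbracket Bbracket a b c.
Proof.
have sp := @malg_spans K Bgen (inl 0%N).
apply: (J_spans (@dsublX K) (@dsublC K) (@dsubrX K) (@dsubrC K) Bbracket_sesq Bbracket_sesq sp sp).
move=> {a b c} _ _ _ [s ->] [t ->] [u ->].
have gA x y z : Bgen_add x (Bgen_add y z) = Bgen_add (Bgen_add x y) z.
  by case: x y z => ? [] ? [] ?; rewrite /= addnA.
have gC x y : Bgen_add x y = Bgen_add y x by case: x y => ? [] ?; rewrite /= addnC.
have E4 : Bbracket (Bvec t) (Bvec (Bgen_add s u)) =
    Bcoef t (Bgen_add s u) *: lconst (Bvec (Bgen_add s (Bgen_add t u))).
  by rewrite BbracketU gA (gC t s) -gA.
have E6 : Bbracket (Bvec (Bgen_add s t)) (Bvec u) =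
    Bcoef (Bgen_add s t) u *: lconst (Bvec (Bgen_add s (Bgen_add t u))).
  by rewrite BbracketU gA.
apply: (J_gen (@dsublX K) (@dsublC K) (@dsubrX K) (@dsubrC K) Bbracket_sesq
  (BbracketU t u) (BbracketU s (Bgen_add t u)) (BbracketU s u) E4 (BbracketU s t) E6).
exact: Bcoef_jacobi.
Qed.

Definition frakB : lieConformalAlgebra K :=
  LieConformalAlgebra Bbracket_sesq Bbracket_skew Bbracket_jacobi.

Definition Vcar : lmodType {poly K} := {poly K}^o.

Section Modules.
Variables a b c d : K.

(* s_λ v = Vcoef s · v on the generator v = 1 of K[∂]. *)
Definition Vcoef (s : Bgen) : {poly {poly K}} :=
  match s with
  | inl 0%N => p%:P%:P * (del + a%:P%:P * lam + b%:P%:P)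
  | inl 1%N => c%:P%:P
  | inr 0%N => d%:P%:P
  | _ => 0
  end.

(* (P(∂)s)_λ (Q(∂)v) = P(-λ) Q(∂+λ) (s_λ v). *)
Definition Vact (x : Bcar) (v : Vcar) : lpoly Vcar :=
  semilin_ext (dsubl K) (fun s => (dsubr K v * Vcoef s) *: lconst (1 : Vcar)) x.

Lemma Vact_sesq : sesquilinear Vact.
Proof.
apply: (semilin_ext_sesq (F := fun s (v : Vcar) => (dsubr K v * Vcoef s) *: lconst (1 : Vcar))).
  by move=> i v w; rewrite rmorphD mulrDl scalerDl.
by move=> i P v; rewrite rmorphM -mulrA -scalerA.
Qed.

Lemma VactU s : Vact (Bvec s) 1 = Vcoef s *: lconst 1.
Proof. by rewrite /Vact semilin_extU rmorph1 mul1r. Qed.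

Lemma V_spans : @spans K Vcar (fun v => v = 1).
Proof.
by move=> Q _ QZ QG x; rewrite -[x]mulr1; apply: QZ; exact: QG.
Qed.

Definition gaE (T : comNzRingType) (i : K -> T) (D L : T) (s : Bgen) : T :=
  match s with
  | inl 0%N => i p * (D + i a * L + i b)
  | inl 1%N => i c
  | inr 0%N => i d
  | _ => 0
  end.

Lemma gaEP (T : comNzRingType) (i : {rmorphism K -> T})
    (f : {rmorphism {poly {poly K}} -> T}) D L s :
  (forall z, f z%:P%:P = i z) -> f del = D -> f lam = L ->
  f (Vcoef s) = gaE i D L s.
Proof.
move=> fC fD fL.
by case: s => [[|[|k]]|[|k]] /=; rewrite ?rmorph0 // ?(rmorphD, rmorphM) /=
  ?fC ?fD ?fL.
Qed.

Hypothesis cP : c = 0 \/ p = -1.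
Hypothesis dP : d = 0 \/ (alpha = p /\ beta = 0).

Lemma gaE_jacobi (T : comNzRingType) (i : {rmorphism K -> T}) (D l m : T) s t :
  gaE i (D + l) m t * gaE i D l s - gaE i (D + m) l s * gaE i D m t
  = gcE i (- (l + m)) l s t * gaE i D (l + m) (Bgen_add s t).
Proof.
have cP' : i c = 0 \/ i p = -1.
  by case: cP => ->; [left; rewrite rmorph0|right; rewrite rmorphN1].
have dP' : i d = 0 \/ (i alpha = i p /\ i beta = 0).
  by case: dP => [->|[-> ->]]; [left; rewrite rmorph0|right; rewrite rmorph0].
case: s t => [[|[|j]]|[|j]] [[|[|k]]|[|k]];
  rewrite /= ?(addn0, add0n, addSn, addnS) /= ?(mul0r, mulr0, subr0) //;
  case: cP' => [E1|E1]; case: dP' => [E2|[E2 E3]]; rewrite ?E2 ?E3 ?E1 //; ring.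
Qed.

Lemma ev2_Vcoef x s : ev2 x (Vcoef s) = gaE CCC 'X%:P%:P x s.
Proof.
by apply: gaEP => [z||]; [exact: ev2C|exact: ev2C|exact: ev2X].
Qed.

Lemma ev3_Vcoef x y s : ev3 (dsubr K) x y (Vcoef s) = gaE CCC (ev2 x (dsubr K 'X)) y s.
Proof.
apply: gaEP => [z||]; [|exact: ev3C|exact: ev3X].
by rewrite ev3C dsubrC; exact: ev2C.
Qed.

Lemma Vact_jacobi x y v : conformal_jacobi Bbracket Vact x y v.
Proof.
have sp := @malg_spans K Bgen (inl 0%N).
apply: (J_spans (@dsublX K) (@dsublC K) (@dsubrX K) (@dsubrC K) Bbracket_sesq Vact_sesq sp V_spans).
move=> {x y v} _ _ _ [s ->] [t ->] ->.
apply: (J_gen (@dsublX K) (@dsublC K) (@dsubrX K) (@dsubrC K) Vact_sesq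
  (VactU t) (VactU s) (VactU s) (VactU t) (BbracketU s t) (VactU _)).
rewrite !ev3_Vcoef (ev3_Bcoef (@dsublC K)) !ev2_Vcoef !ev2sr ev2sl.
exact: gaE_jacobi.
Qed.

Definition V_gen : conformalModule frakB :=
  @ConformalModule K frakB Vcar Vact Vact_sesq Vact_jacobi.

End Modules.

Definition V_ab (a b : K) : conformalModule frakB :=
  V_gen a b (or_introl (erefl 0)) (or_introl (erefl 0)).

Lemma pairP (q : K) : (alpha, beta) = (q, 0) -> q = p -> alpha = p /\ beta = 0.
Proof. by case=> -> -> ->. Qed.

Definition V_abd (h : (alpha, beta) = (p, 0)) (a b d : K) :
    conformalModule frakB :=
  V_gen a b (or_introl (erefl 0)) (or_intror (pairP h (erefl p))) (d := d).

Definition V_abc (hp : p = -1) (a b c : K) : conformalModule frakB :=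
  V_gen a b (or_intror hp) (or_introl (erefl 0)) (c := c).

Definition V_abcd (hp : p = -1) (h : (alpha, beta) = (-1, 0)) (a b c d : K) :
    conformalModule frakB :=
  V_gen a b (or_intror hp) (or_intror (pairP h (esym hp))) (c := c) (d := d).

End Concrete.

(* Main.v *)
Require Import Defs.
From HB Require Import structures.
From mathcomp Require Import all_boot all_order all_algebra.
From mathcomp Require Import reals complex.
From mathcomp Require Import finmap monalg ring.
Import GRing.Theory.
Local Open Scope ring_scope.

(* On a free module of rank one with generator v, write s_lambda v = F_s v with
   F_s in C[del][lambda].  Only the coefficients of mu^0 and mu^1 in the Jacobi
   identity are needed.  For the pair (L_0, L_0) they force F_{L_0} = 0, and then
   the action is trivial, or F_{L_0} = p (del + a lambda + b).  In the second case
   the coefficient of mu^1 for (s, L_0) is Euler's identity: F_{L_j} and F_{W_j}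
   are homogeneous in (del + b, lambda), of degree 1 + j/p and (j + alpha - p)/p,
   the latter only if beta = 0.

   If p <> -1 and F_{L_1} <> 0, then F_{L_2} <> 0.  The pair (L_0, L_j) says that
   F_{L_j} intertwines densities, and comparing coefficients up to lambda^3 gives
   12 (a^2 - a) = (N - 2)(N + 1) for its degree N >= 2.  The degrees of F_{L_1}
   and F_{L_2} differ, so this is absurd; hence F_{L_1} = 0, and bracketing with
   L_1 kills all F_{L_j} with j >= 2.  If p = -1, the degrees 1 - j leave only a
   constant F_{L_1}.  Finally, commutativity of the W_j makes each F_{W_j} a
   constant, and bracketing with L_1 kills it for j >= 1. *)

Set Implicit Arguments.
Unset Strict Implicit.
Unset Printing Implicit Defensive.

(** * Taylor coefficients in [mu] of the substitutions in the Jacobi identity *)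

Lemma coefM1 (R : nzRingType) (f g : {poly R}) :
  (f * g)`_1 = f`_0 * g`_1 + f`_1 * g`_0.
Proof. by rewrite coefM !big_ord_recr big_ord0 /= add0r. Qed.

Section PolyCoef.
Variable K : fieldType.
Notation P1 := {poly K}.
Notation P2 := {poly {poly K}}.
Notation P3 := {poly {poly {poly K}}}.
Notation la := ('X%:P : P3).
Notation mu := ('X : P3).

Lemma ev2_la (F : P2) : ev2 la F = F%:P.
Proof.
by apply: (@poly_morph_ext _ _ (ev2 la) polyC) => [|s]; rewrite ?ev2X ?ev2C.
Qed.

Lemma coef_ev2_mu (F : P2) k : (ev2 mu F)`_k = (F`_k)%:P.
Proof.
have -> : ev2 mu F = map_poly polyC F.
  apply: (@poly_morph_ext _ _ (ev2 mu) (map_poly polyC)) => [|s].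
    by rewrite ev2X /= map_polyX.
  by rewrite ev2C /= map_polyC.
by rewrite coef_map.
Qed.

Lemma coef_ev3_la_mu (F : P2) k : (ev3 (dsubr K) la mu F)`_k = dsubr K F`_k.
Proof.
have -> : ev3 (dsubr K) la mu F = map_poly (dsubr K) F.
  apply: (@poly_morph_ext _ _ (ev3 (dsubr K) la mu) (map_poly (dsubr K))) => [|s].
    by rewrite ev3X /= map_polyX.
  by rewrite ev3C ev2_la /= map_polyC.
by rewrite coef_map.
Qed.

(** First-order Taylor expansion of [F(del, lambda + mu)] at [mu = 0]. *)
Lemma coef_ev2_la_mu (F : P2) :
  (ev2 (la + mu) F)`_0 = F /\ (ev2 (la + mu) F)`_1 = F^`().
Proof.
elim/poly_ind: F => [|F c [IH0 IH1]]; first by rewrite rmorph0 !coef0 deriv0.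
rewrite rmorphD rmorphM /= ev2X ev2C mulrDr !coefD !coefMC !coefMX !coefC /=.
rewrite IH0 IH1 derivD derivM derivX derivC mulr1 !addr0; split => //.
Qed.

(** Taylor's formula for [P(del + lambda)], as a recursion that avoids dividing by factorials. *)
Lemma coef_dsubr (P : P1) k : (dsubr K P)`_k.+1 *+ k.+1 = ((dsubr K P)`_k)^`().
Proof.
elim/poly_ind: P k => [|P c IH] k; first by rewrite rmorph0 !coef0 mul0rn linear0.
rewrite rmorphD rmorphM /= dsubrX dsubrC mulrDr !coefD !coefMC !coefMX !coefC /=.
case: k => [|k] /=.
  rewrite !addr0 mulrnDl !mulr1n derivD derivM derivX derivC -IH mulr1n mulr1.
  by rewrite addr0.
rewrite !addr0 mulrnDl -mulrnAl IH derivD derivM derivX mulr1 -IH.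
by rewrite -!/(dsubr K P) -IH -addrA -mulrS.
Qed.

Lemma coef_dsubr0 (P : P1) : (dsubr K P)`_0 = P.
Proof.
elim/poly_ind: P => [|P c IH]; first by rewrite rmorph0 coef0.
rewrite rmorphD rmorphM /= dsubrX dsubrC mulrDr !coefD !coefMC !coefMX !coefC /=.
by rewrite IH addr0.
Qed.

Lemma coef_dsubr1 (P : P1) : (dsubr K P)`_1 = P^`().
Proof. by rewrite -[LHS]mulr1n coef_dsubr coef_dsubr0. Qed.

(** First-order expansion of [F(del + mu, lambda)]; its linear term is the derivative in [del],
    hence taken coefficientwise. *)
Lemma coef_ev3_mu_la (F : P2) :
  (ev3 (dsubr K) mu la F)`_0 = F /\
  (ev3 (dsubr K) mu la F)`_1 = map_poly (@deriv _) F.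
Proof.
elim/poly_ind: F => [|F c [IH0 IH1]].
  by rewrite rmorph0 !coef0 map_poly0.
rewrite rmorphD rmorphM /= ev3X ev3C !coefD !coefMC !coef_ev2_mu.
rewrite IH0 IH1 coef_dsubr0 coef_dsubr1; split => //.
apply/polyP => k; rewrite coefD coef_map_id0 ?linear0 // coefMX coefD coefMX.
rewrite !coefC coef_map_id0 ?linear0 //.
by case: k => [|k] /=; rewrite derivD ?linear0 ?add0r.
Qed.

End PolyCoef.

(** * The Jacobi identity on generators at [mu^0] and [mu^1] *)

Section JacobiCoef.
Variables (K : fieldType) (alpha beta p : K) (F : Bgen -> {poly {poly K}}).
Notation P1 := {poly K}.
Notation P2 := {poly {poly K}}.
Notation P3 := {poly {poly {poly K}}}.
Notation la := ('X%:P : P3).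
Notation mu := ('X : P3).
Notation CC z := (z%:P%:P : P2).

(** In usual notation, with [B] for [Bcoef]: [F_t(del + lambda, mu) F_s(del, lambda) - F_s(del + mu,
    lambda) F_t(del, mu) = B_{s,t}(- lambda - mu, lambda) F_{s+t}(del, lambda + mu)]. *)
Definition jacobi_coefs : Prop := forall s t,
  ev3 (dsubr K) la mu (F t) * ev2 la (F s)
  - ev3 (dsubr K) mu la (F s) * ev2 mu (F t)
  = ev3 (dsubl K) (la + mu) la (Bcoef alpha beta p s t)
    * ev2 (la + mu) (F (Bgen_add s t)).

(* [Bmu0 s t + Bmu1 s t * mu] is the coefficient of [s_lambda t] at
   [del = - lambda - mu]. *)
Definition Bmu0 (s t : Bgen) : P2 :=
  match s, t with
  | inl i, inl j => CC (j%:R + p) * 'X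
  | inl i, inr j => CC (j%:R + alpha - p) * 'X + CC ((i%:R + p) * beta)
  | inr j, inl i => CC (i%:R + p) * ('X - CC beta)
  | inr _, inr _ => 0
  end.

Definition Bmu1 (s t : Bgen) : P2 :=
  match s, t with
  | inl i, inl j => - CC (i%:R + p)
  | inl i, inr j => - CC (i%:R + p)
  | inr j, inl i => - CC (j%:R + alpha - p)
  | inr _, inr _ => 0
  end.

Definition shift_diff (P : P1) : P2 := dsubr K P - P%:P.

Lemma Bcoef_mu s t :
  ev3 (dsubl K) (la + mu) la (Bcoef alpha beta p s t)
  = (Bmu0 s t)%:P + (Bmu1 s t)%:P * 'X.
Proof.
rewrite (ev3_Bcoef alpha beta p (@dsublC K)) ev2sl.
case: s t => i [] j; rewrite /CCC /= ?polyCN ?polyCD ?polyCM ?polyCN ?polyC_natr;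
  ring.
Qed.

(** At [mu = 0] both products on the left share the factor [F_s(del, lambda)], and [F_t] enters only
    through its constant term, once at [del + lambda] and once at [del]. *)
Lemma jacobi_mu0 (J : jacobi_coefs) s t :
  shift_diff (F t)`_0 * F s = Bmu0 s t * F (Bgen_add s t).
Proof.
have [e0 e1] := coef_ev2_la_mu (F (Bgen_add s t)).
have [d0 d1] := coef_ev3_mu_la (F s).
have := congr1 (fun G : P3 => G`_0) (J s t).
rewrite Bcoef_mu coefB !coef0M coefD coefC coefMX addr0 e0.
rewrite ev2_la coefC coef_ev3_la_mu d0 coef_ev2_mu /= => <-.
by rewrite mulrBl; congr (_ - _); rewrite mulrC.
Qed.

Lemma jacobi_mu1 (J : jacobi_coefs) s t :
  shift_diff (F t)`_1 * F s - ((F t)`_0)%:P * map_poly (@deriv _) (F s)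
  = Bmu0 s t * (F (Bgen_add s t))^`() + Bmu1 s t * F (Bgen_add s t).
Proof.
have [e0 e1] := coef_ev2_la_mu (F (Bgen_add s t)).
have [d0 d1] := coef_ev3_mu_la (F s).
have := congr1 (fun G : P3 => G`_1) (J s t).
rewrite Bcoef_mu coefB !coefM1 !coefD !coefC !coefCM !coefX /= e0.
rewrite e1.
rewrite ev2_la !coefC !coef_ev3_la_mu d0 d1.
rewrite !coef_ev2_mu /= ?(addr0, add0r, mulr0, mulr1) => <-.
rewrite /shift_diff; ring.
Qed.

End JacobiCoef.

(** * Euler's identity and homogeneity *)

Section Euler.
Variables (K : fieldType) (b : K).
Hypothesis char0 : [pchar K] =i pred0.
Notation P1 := {poly K}.
Notation P2 := {poly {poly K}}.

Lemma natrS_neq0 n : n.+1%:R != 0 :> K.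
Proof. by rewrite (pcharf0P K).1. Qed.

Lemma natr_inj : injective (fun n : nat => n%:R : K).
Proof.
move=> m n /= E; wlog le : m n E / (m <= n)%N.
  by move=> H; case/orP: (leq_total m n) => le; [|symmetry]; apply: H.
move: E; rewrite -(subnK le) natrD => E; case: (n - m)%N E => // k.
by rewrite -[LHS]add0r => /addIr /esym /eqP; rewrite (negPf (natrS_neq0 _)).
Qed.

(** Compare coefficients in degree [deg u]: on the left it is [deg u] times the leading coefficient
    of [u]. *)
Lemma euler_size (c : K) (u : P1) : u != 0 ->
  ('X + b%:P) * u^`() = c%:P * u -> c = (size u).-1%:R.
Proof.
move=> u0 /(congr1 (fun q : P1 => q`_(size u).-1)).
rewrite mulrDl coefD coefXM !coefCM !coef_deriv -/(lead_coef u).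
rewrite [u`_(size u).-1.+1]nth_default ?leqSpred // mul0rn mulr0 addr0.
have l0 : lead_coef u != 0 by rewrite lead_coef_eq0.
case E: (size u).-1 => [|n] /= H; apply: (mulIf l0); rewrite -H ?mul0r //.
by rewrite /lead_coef E mulr_natl.
Qed.

(* Euler's identity: F is homogeneous of degree c in del + b and lambda. *)
Definition euler (c : K) (F : P2) : Prop :=
  ('X + b%:P)%:P * map_poly (@deriv _) F + 'X * F^`() = c%:P%:P * F.

Lemma euler_coef c F k : euler c F ->
  ('X + b%:P) * (F`_k)^`() = (c - k%:R)%:P * F`_k.
Proof.
move=> /(congr1 (fun q : P2 => q`_k)).
rewrite coefD !coefCM coef_map_id0 ?linear0 // coefXM coef_deriv => E.
rewrite polyCB mulrBl -E polyC_natr mulr_natl -[LHS]addr0 -addrA; congr (_ + _).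
by case: k {E} => [|k] /=; rewrite ?mulr0n subrr.
Qed.

(** A nonzero coefficient of [lambda^k] satisfies the one-variable identity of degree [c - k], so
    [c] is a total degree and in particular a natural number. *)
Lemma euler_natr c F k : euler c F -> F`_k != 0 ->
  c = (k + (size F`_k).-1)%:R.
Proof.
move=> /(euler_coef k) E /euler_size/(_ E) /eqP.
by rewrite subr_eq addrC -natrD => /eqP.
Qed.

Lemma euler_const F : euler 0 F -> exists c, F = c%:P%:P.
Proof.
move=> E; exists F`_0`_0.
have Fk k : F`_k != 0 -> (k + (size (F`_k)%R).-1 = 0)%N.
  by move=> /(euler_natr E) H; apply: natr_inj; rewrite /= -H.
have F0 : F`_0 = (F`_0`_0)%:P.
  apply: size1_polyC; have [->|/Fk] := eqVneq F`_0 0; first by rewrite size_poly0.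
  by rewrite add0n; case: (size _) => [|[]].
apply/polyP => -[|k]; rewrite coefC //=.
by apply/eqP; apply: contraT => /Fk.
Qed.

End Euler.

(** * The increments [P(del + lambda) - P(del)] *)

Section Shift.
Variables (K : fieldType).
Notation P1 := {poly K}.
Notation P2 := {poly {poly K}}.

Lemma shift_diff0 : shift_diff (0 : P1) = 0.
Proof. by rewrite /shift_diff rmorph0 subr0. Qed.

Lemma shift_diffC c : shift_diff (c%:P : P1) = 0.
Proof. by rewrite /shift_diff dsubrC subrr. Qed.

Lemma coefS_shift_diff (u : P1) k : (shift_diff u)`_k.+1 = (dsubr K u)`_k.+1.
Proof. by rewrite coefB coefC subr0. Qed.

Lemma coef1_shift_diff (u : P1) : (shift_diff u)`_1 = u^`().
Proof. by rewrite coefS_shift_diff coef_dsubr1. Qed.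

End Shift.

(** * The weight equation for intertwiners of densities *)

Section Intertwiner.
Variables (K : fieldType) (a b N : K) (h : {poly {poly K}}).
Notation P1 := {poly K}.
Notation P2 := {poly {poly K}}.
Let x : P1 := 'X + b%:P.
Let u := h`_0.
Let e := h`_1.
(** For [h = F_{L_j}] and [N = (j + p) / p], [h0] and [h1] are the [mu^0] and [mu^1] relations of
    the pair [(L_0, L_j)], divided by [p]. *)
Hypothesis h_euler : euler b N h.
Hypothesis h0 : shift_diff u * (x%:P + a%:P%:P * 'X) = N%:P%:P * 'X * h.
Hypothesis h1 : shift_diff e * (x%:P + a%:P%:P * 'X) - u%:P
  = N%:P%:P * 'X * h^`() - h.

Let coef_shift_diffM (q : P1) k :
  (shift_diff q * (x%:P + a%:P%:P * 'X))`_k.+1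
  = (shift_diff q)`_k.+1 * x + a%:P * (shift_diff q)`_k.
Proof.
by rewrite mulrDr coefD coefMC mulrA coefMX /= mulrC coefMC mulrC [_ * a%:P]mulrC.
Qed.

Lemma intertwiner_weight : N != 0 -> N != 1 -> u != 0 ->
  12%:R * (a ^+ 2 - a) = (N - 2%:R) * (N + 1).
Proof.
move=> N0 N1 u0.
have t2 (q : P1) : (shift_diff q)`_2 *+ 2 = q^`()^`().
  by rewrite coefS_shift_diff coef_dsubr coef_dsubr1.
have t3 (q : P1) : (shift_diff q)`_3 *+ 6 = q^`()^`()^`().
  rewrite -(t2 q) !coefS_shift_diff -[LHS]/(_ *+ (3 * 2)) mulrnA (coef_dsubr _ 2).
  by rewrite derivMn.
have E1 : x * u^`() = N%:P * u by rewrite (euler_coef 0 h_euler) subr0.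
have E2 : x * u^`()^`() = (N - 1)%:P * u^`().
  have := congr1 (@deriv _) E1.
  rewrite !derivM !derivE mul0r add0r addr0 mul1r => E.
  by rewrite polyCB mulrBl -E mul1r addrC addKr.
have E3 : x * u^`()^`()^`() = (N - 2)%:P * u^`()^`().
  have := congr1 (@deriv _) E2.
  rewrite !derivM !derivE mul0r add0r addr0 mul1r => E.
  have -> : N - 2 = N - 1 - 1 by ring.
  by rewrite [in RHS]polyCB mulrBl -E mul1r addrC addKr.
have H2 := congr1 (fun q : P2 => q`_2) h0.
have H3 := congr1 (fun q : P2 => q`_3) h0.
have G2 := congr1 (fun q : P2 => q`_2) h1.
move: H2 H3 G2.
rewrite /= !coefB !coef_shift_diffM -!mulrA !coefCM !coefXM /= coef_deriv coefC /=.
rewrite subr0 -/e !coef1_shift_diff => H2 H3 G2.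
(* The coefficients of [lambda^2] and [lambda^3] in [h0] determine [e] and the next coefficient of
   [h] in terms of derivatives of [u]. *)
have Ee : (N *+ 2)%:P * e = (N - 1 + a *+ 2)%:P * u^`().
  transitivity ((N%:P * e) *+ 2); first by ring.
  rewrite -H2 mulrnDl -mulrnAl t2 mulrC E2; ring.
have Ee1 : (N *+ 2)%:P * e^`() = (N - 1 + a *+ 2)%:P * u^`()^`().
  by have := congr1 (@deriv _) Ee; rewrite !derivM !derivC !mul0r !add0r.
have Ee2 : (N *+ 2)%:P * e^`()^`() = (N - 1 + a *+ 2)%:P * u^`()^`()^`().
  by have := congr1 (@deriv _) Ee1; rewrite !derivM !derivC !mul0r !add0r.
have Eh : (N *+ 6)%:P * h`_2 = (N - 2 + a *+ 3)%:P * u^`()^`().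
  transitivity ((N%:P * h`_2) *+ 6); first by ring.
  rewrite -H3 mulrnDl -mulrnAl t3 mulrC E3 -[6%N]/(2 * 3)%N mulrnA -mulrnAr t2.
  ring.
(* Substituting these values into the [lambda^2] coefficient of [h1] leaves a scalar multiple of
   [u'']; [Q] is that scalar. *)
pose Q := 12%:R * (a ^+ 2 - a) - (N - 2%:R) * (N + 1).
have EQ : Q%:P * u^`()^`() = 0.
  have -> : Q = 3%:R * (N - 1 + a *+ 2) * (N - 2 + a *+ 2)
                - 2%:R * (N *+ 2 - 1) * (N - 2 + a *+ 3) by rewrite /Q; ring.
  transitivity ((3%:R * (N - 1 + a *+ 2) * (N - 2 + a *+ 2))%:P * u^`()^`()
     - (2%:R * (N *+ 2 - 1))%:P * ((N - 2 + a *+ 3)%:P * u^`()^`())); first by ring.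
  rewrite -Eh.
  transitivity (3%:R * ((N - 1 + a *+ 2)%:P * ((N - 2)%:P * u^`()^`())
     + (a *+ 2)%:P * ((N - 1 + a *+ 2)%:P * u^`()^`()))
     - 12%:R * N%:P * (N%:P * (h`_2 *+ 2) - h`_2)).
    ring.
  rewrite -E3 -Ee1 mulrCA -Ee2 -G2.
  transitivity (6%:R * N%:P * x * (e^`()^`() - (shift_diff e)`_2 *+ 2)).
    ring.
  by rewrite t2 subrr mulr0.
(* If [u''] vanished, [E2] and [N != 1] would give [u' = 0], and then [E1] and [N != 0] would give
   [u = 0]. *)
have /eqP := EQ; rewrite mulf_eq0 polyC_eq0 => /orP[|/eqP D2].
  by rewrite subr_eq0 => /eqP.
have /esym/eqP := E2; rewrite D2 mulr0 mulf_eq0 polyC_eq0 subr_eq0 (negPf N1).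
move=> /eqP D1; have /esym/eqP := E1.
by rewrite D1 mulr0 mulf_eq0 polyC_eq0 (negPf N0) (negPf u0).
Qed.

End Intertwiner.

(** * Solving the relations for the action on the generators *)

Section Classification.
Variables (K : fieldType) (alpha beta p : K) (F : Bgen -> {poly {poly K}}).
Hypothesis char0 : [pchar K] =i pred0.
Hypothesis p0 : p != 0.
Hypothesis J : jacobi_coefs alpha beta p F.
Notation P1 := {poly K}.
Notation P2 := {poly {poly K}}.
Notation CC z := (z%:P%:P : P2).
Notation L i := (F (inl i)).
Notation W i := (F (inr i)).

Lemma map_deriv0 : map_poly (@deriv K) 0 = 0.
Proof. by apply/polyP => k; rewrite coef_map_id0 ?linear0 // coef0 linear0. Qed.

Lemma CC_eq0 (c : K) : (CC c == 0) = (c == 0).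
Proof. by rewrite !polyC_eq0. Qed.

(** A vanishing derivative is Euler's equation with [b = c = 0], so [u] has degree 0. *)
Lemma deriv_eq0 (u : P1) : u^`() = 0 -> u = (u`_0)%:P.
Proof.
move=> E; apply: size1_polyC; have [->|u0] := eqVneq u 0; first by rewrite size_poly0.
have := @euler_size K 0 0 u u0.
rewrite E !mulr0 mul0r => /(_ erefl) /(@natr_inj _ char0 0 _).
by case: (size u) => [|[]].
Qed.

(** In both relations for [(L_0, s)] the left-hand side vanishes. If [F_s] did not, [Bmu0] and then
    [Bmu1] would be 0, but the latter is [- p]. *)
Lemma trivial_of_L0 : L 0 = 0 -> forall s, F s = 0.
Proof.
move=> L0 s; apply/eqP; apply: contraT => Fs.
have E : Bgen_add (inl 0%N) s = s by case: s {Fs}.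
have := jacobi_mu0 J (inl 0%N) s.
have := jacobi_mu1 J (inl 0%N) s.
rewrite E L0 map_deriv0 !mulr0 subr0 => H1 /esym/eqP.
rewrite mulf_eq0 (negPf Fs) orbF => /eqP H0; move/esym/eqP: H1.
rewrite H0 mul0r add0r mulf_eq0 (negPf Fs) orbF.
by case: s {E Fs H0} => j; rewrite /= oppr_eq0 CC_eq0 add0r (negPf p0).
Qed.

Lemma L0_form : L 0 != 0 ->
  exists a b, L 0 = CC p * ('X%:P + CC a * 'X + CC b).
Proof.
move=> f0; have := jacobi_mu0 J (inl 0%N) (inl 0%N).
have := jacobi_mu1 J (inl 0%N) (inl 0%N).
rewrite /= add0r addn0; move: f0; move: (L 0) => f f0 H1 /(mulIf f0) H0.
have u1 : (f`_0)^`() = p%:P.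
  by rewrite -coef1_shift_diff H0 coefCM coefX mulr1.
pose b := (f`_0)`_0 / p.
have u0 : f`_0 = p%:P * ('X + b%:P).
  have /deriv_eq0 : (f`_0 - p%:P * 'X)^`() = 0.
    by rewrite derivB u1 derivM derivC mul0r add0r derivX mulr1 subrr.
  rewrite coefB coefCM coefX mulr0 subr0 => /eqP.
  rewrite subr_eq => /eqP ->; rewrite mulrDr -polyCM [p * b]mulrC divfK //.
  by rewrite addrC.
rewrite u0 in H1; have e1 : (f`_1)^`() = 0.
  (* The right-hand side of [HG] has [lambda]-degree at most that of [f], so [G] is constant in
     [lambda]; its coefficient of [lambda] is the derivative of the coefficient of [lambda] in
     [f]. *)
  pose G := shift_diff f`_1 + CC p.
  have HG : G * f = (p%:P * ('X + b%:P))%:P * map_poly (@deriv _) f + CC p * 'X * f^`().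
    rewrite /G mulrDl; move/eqP: H1; rewrite subr_eq => /eqP ->.
    by ring.
  have sG : (size G <= 1)%N.
    have [->|G0] := eqVneq G 0; first by rewrite size_poly0.
    have sf : (size (G * f)%R <= size f)%N.
      rewrite HG; apply/leq_sizeP => j le.
      rewrite coefD coefCM coef_map_id0 ?linear0 // nth_default // linear0 mulr0.
      rewrite -mulrA coefCM coefXM add0r.
      case: j le => [|j] le /=; first by rewrite mulr0.
      by rewrite coef_deriv nth_default // mul0rn mulr0.
    move: sf; rewrite size_mul //; have := f0; rewrite -size_poly_gt0.
    by case: (size f) => // n _; rewrite addnS /= -[X in (_ <= X)%N]add1n leq_add2r.
  rewrite -coef1_shift_diff; have : G`_1 = 0 by rewrite nth_default.
  by rewrite coefD coefC addr0.
have e0 := deriv_eq0 e1.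
exists ((f`_1)`_0 / p), b.
(* Once that coefficient is a constant, its increment drops out and the [mu^1] relation is Euler's
   identity of degree 1, which excludes all powers of [lambda] above the first. *)
have E : euler b 1 f.
  have cp0 : CC p != 0 by rewrite CC_eq0.
  apply: (mulfI cp0); rewrite /euler.
  move: H1; rewrite e0 shift_diffC mul0r sub0r => H1.
  transitivity ((p%:P * ('X + b%:P))%:P * map_poly (@deriv _) f + CC p * 'X * f^`()).
    ring.
  by rewrite -[X in X + _]opprK H1; ring.
apply/polyP => -[|[|k]].
- rewrite u0 coefCM !coefD coefC coefCM coefX coefC /=; ring.
- rewrite {1}e0 coefCM !coefD coefC coefCM coefX coefC /=.
  have {1}<- : p * ((f`_1)`_0 / p) = (f`_1)`_0 by rewrite mulrC divfK.
  ring.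
- rewrite coefCM !coefD coefC coefCM coefX coefC /= mulr0 !addr0 mulr0.
  apply/eqP; apply: contraT => /(euler_natr E) /(@natr_inj _ char0 1 _).
  by rewrite addSn addSn.
Qed.

Section NonTrivial.
Variables a b : K.
Hypothesis L0E : L 0 = CC p * ('X%:P + CC a * 'X + CC b).

Lemma L0_coef0 : (L 0)`_0 = p%:P * ('X + b%:P).
Proof. by rewrite L0E coefCM !coefD coefC coefCM coefX coefC /=; ring. Qed.

Lemma L0_coef1 : (L 0)`_1 = (p * a)%:P.
Proof. by rewrite L0E coefCM !coefD coefC coefCM coefX coefC /=; ring. Qed.

Lemma shift_diff_L0 : shift_diff (L 0)`_0 = CC p * 'X.
Proof.
rewrite L0_coef0 /shift_diff rmorphM rmorphD /= !dsubrC dsubrX; ring.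
Qed.

Lemma euler_scale c G : euler b (c / p) G <->
  (p%:P * ('X + b%:P))%:P * map_poly (@deriv _) G + CC p * 'X * G^`() = CC c * G.
Proof.
have cp0 : CC p != 0 by rewrite CC_eq0.
have E : CC c = CC p * CC (c / p) by rewrite -!polyCM mulrC divfK.
rewrite E /euler; split=> [H|H].
  by rewrite -[RHS]mulrA -H; ring.
by apply: (mulfI cp0); rewrite mulrA -H; ring.
Qed.

Lemma L_euler i : euler b ((i%:R + p) / p) (L i).
Proof.
apply/euler_scale; have := jacobi_mu1 J (inl i) (inl 0%N).
rewrite L0_coef0 L0_coef1 shift_diffC mul0r sub0r /= addn0 add0r => /(congr1 -%R).
by rewrite opprK => ->; ring.
Qed.

(** For [(W_j, L_0)] the [mu^0] relation reads [p lambda W_j = p (lambda - beta) W_j], whence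
    [beta = 0]; the [mu^1] relation is then Euler's. *)
Lemma W_euler j : W j != 0 ->
  beta = 0 /\ euler b ((j%:R + alpha - p) / p) (W j).
Proof.
move=> W0; have := jacobi_mu0 J (inr j) (inl 0%N).
rewrite shift_diff_L0 /= addn0 add0r => /(mulIf W0) /eqP.
rewrite mulrBr -subr_eq0 opprB addrC subrK mulf_eq0 !CC_eq0 (negPf p0) /= => /eqP b0.
split=> //; apply/euler_scale; have := jacobi_mu1 J (inr j) (inl 0%N).
rewrite L0_coef0 L0_coef1 shift_diffC mul0r sub0r /= addn0 add0r => /(congr1 -%R).
by rewrite opprK b0 => ->; ring.
Qed.

(** Since [[W_j, W_j] = 0], the increment of the constant term of [W_j] is 0. The pair [(L_0, W_j)]
    then gives [j + alpha - p = 0], so the Euler degree is 0. *)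
Lemma W_const j : W j != 0 ->
  [/\ beta = 0, j%:R + alpha - p = 0 & exists c, W j = CC c].
Proof.
move=> W0; have [b0 E] := W_euler W0.
suff c0 : j%:R + alpha - p = 0.
  by rewrite c0 mul0r in E; split=> //; exact: euler_const E.
have := jacobi_mu0 J (inr j) (inr j).
rewrite /= mul0r => /eqP; rewrite mulf_eq0 (negPf W0) orbF => /eqP D0.
have := jacobi_mu0 J (inl 0%N) (inr j).
rewrite D0 mul0r /= add0n b0 mulr0 addr0 => /esym/eqP.
by rewrite !mulf_eq0 (negPf W0) CC_eq0 polyX_eq0 !orbF => /eqP.
Qed.

(** The scalars [j + alpha - p] for [j] and [j + 1] cannot both vanish, so [W_{j+1} != 0] forces
    [W_j = 0]; the pair [(L_1, W_j)] then reads [0 = - lambda W_{j+1}]. *)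
Lemma WS_eq0 j : W j.+1 = 0.
Proof.
apply/eqP; apply: contraT => W1; have [b0 c1 _] := W_const W1.
have Wj : W j = 0.
  apply/eqP; apply: contraT => W0; have [_ c0 _] := W_const W0.
  have := c1; rewrite -[X in _ = X]c0 => /addIr/addIr/(natr_inj char0) /eqP.
  by rewrite -[X in X == _]addn1 -[X in _ == X]addn0 eqn_add2l.
have := jacobi_mu0 J (inl 1%N) (inr j).
rewrite Wj coef0 shift_diff0 mul0r /= add1n b0 mulr0 addr0 => /esym/eqP.
rewrite !mulf_eq0 (negPf W1) CC_eq0 polyX_eq0 !orbF.
have -> : j%:R + alpha - p = -1.
  by apply/eqP; rewrite -subr_eq0 opprK -c1 -natr1; apply/eqP; ring.
by rewrite oppr_eq0 oner_eq0.
Qed.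

Lemma L_weight j : (j%:R + p) / p != 0 -> (j%:R + p) / p != 1 -> L j != 0 ->
  12%:R * (a ^+ 2 - a) = ((j%:R + p) / p - 2%:R) * ((j%:R + p) / p + 1).
Proof.
set N := (_ / p) => N0 N1 Lj.
have cp0 : CC p != 0 by rewrite CC_eq0.
have pN : j%:R + p = p * N by rewrite mulrC divfK.
have H0 : shift_diff (L j)`_0 * (('X + b%:P)%:P + CC a * 'X) = CC N * 'X * L j.
  apply: (mulfI cp0); have := jacobi_mu0 J (inl 0%N) (inl j).
  rewrite L0E /= add0n pN => H.
  transitivity (CC (p * N) * 'X * L j); last by ring.
  by rewrite -H; ring.
apply: (@intertwiner_weight _ a b N _ (L_euler j) H0) => //.
  apply: (mulfI cp0); have := jacobi_mu1 J (inl 0%N) (inl j).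
  have -> : map_poly (@deriv _) (L 0) = CC p.
    apply/polyP => k; rewrite coef_map_id0 ?linear0 // L0E.
    rewrite !(coefCM, coefD, coefC, coefX).
    case: k => [|[|k]] /=; rewrite !derivE; ring.
  rewrite L0E /= add0n pN add0r => H.
  transitivity (CC (p * N) * 'X * (L j)^`() - CC p * L j); last by ring.
  rewrite -mulNr -H; ring.
(* A zero constant term would turn [H0] into [N lambda L_j = 0]. *)
apply/eqP => u0; move: H0; rewrite u0 shift_diff0 mul0r => /esym/eqP.
by rewrite !mulf_eq0 CC_eq0 (negPf N0) polyX_eq0 (negPf Lj).
Qed.

Lemma L1_eq0 : p != -1 -> L 1 = 0.
Proof.
move=> p1; apply/eqP; apply: contraT => L10.
have p1' : 1 + p != 0 by rewrite addrC addr_eq0.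
have u1 : shift_diff (L 1)`_0 != 0.
  apply/eqP => u0; have := jacobi_mu0 J (inl 0%N) (inl 1%N).
  rewrite u0 mul0r /= => /esym/eqP.
  by rewrite !mulf_eq0 CC_eq0 (negPf L10) (negPf p1') polyX_eq0.
have L20 : L 2 != 0.
  apply/eqP => L2; have := jacobi_mu0 J (inl 1%N) (inl 1%N).
  by rewrite /= addn1 L2 mulr0 => /eqP; rewrite mulf_eq0 (negPf u1) (negPf L10).
have [k Lk] : exists k, (L 1)`_k != 0.
  by exists (size (L 1)).-1; rewrite -/(lead_coef _) lead_coef_eq0.
have := euler_natr (L_euler 1) Lk; set n := (k + _)%N => En.
have kE : 1 = p * (n%:R - 1) by rewrite -En; field.
(* Here [n] is the degree [1 + 1/p] of [L_1]: the value 0 means [p = -1], the value 1 means [1 = 0],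
   and from now on the degree is [n + 2]. *)
case: n En kE => [|[|n]] En kE.
- by case/eqP: p1; rewrite kE; ring.
- by move/eqP: kE; rewrite subrr mulr0 oner_eq0.
have kE' : p * n.+1%:R = 1 by rewrite [RHS]kE -(natr1 n.+1) addrK.
have E1 : (1 + p) / p = n.+2%:R by [].
have E2 : (2%:R + p) / p = (n.*2.+3)%:R.
  apply: (mulIf p0); rewrite divfK //.
  transitivity (2%:R * (p * n.+1%:R) + p); first by rewrite kE' mulr1.
  rewrite -addn3 -addnn !natrD -natr1; ring.
have N0 m : m.+2%:R != 0 :> K by exact: natrS_neq0.
have N1 m : m.+2%:R != 1 :> K by apply/eqP => /(@natr_inj _ char0 _ 1).
have := @L_weight 2; rewrite E2 => /(_ (N0 _) (N1 _) L20).
have := @L_weight 1; rewrite E1 => /(_ (N0 _) (N1 _) L10) -> E.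
(* The degrees are n + 2 and 2 n + 3; subtracting the two weight equations
   leaves 3 n^2 + 7 n + 4 = 0. *)
have /eqP[] : (3 * n * n + 7 * n + 3).+1%:R != 0 :> K by exact: natrS_neq0.
move: E; rewrite -addn3 -addnn -[n.+2]addn2 -[(_ + _).+1]addn1 !natrD !natrM.
move: (n%:R) => m E; rewrite -(subrr ((m + 2%:R - 2%:R) * (m + 2%:R + 1))) {1}E; ring.
Qed.

(** With [L_1 = 0], the pair [(L_{j+1}, L_1)] reads [0 = (1 + p) lambda L_{j+2}]. *)
Lemma LS_eq0 j : p != -1 -> L j.+1 = 0.
Proof.
move=> p1; have L1 := L1_eq0 p1; case: j => // j.
have := jacobi_mu0 J (inl j.+1) (inl 1%N).
rewrite L1 coef0 shift_diff0 mul0r /= addn1 => /esym/eqP.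
by rewrite !mulf_eq0 CC_eq0 polyX_eq0 addrC addr_eq0 (negPf p1) /= => /eqP.
Qed.

Lemma L1_const : p = -1 -> exists c, L 1 = CC c.
Proof.
move=> p1; apply: (@euler_const K b char0).
by have := L_euler 1; rewrite {1}p1 subrr mul0r.
Qed.

(** The Euler degree would be [- (j + 1)], which is not a natural number in characteristic 0. *)
Lemma LSS_eq0 j : p = -1 -> L j.+2 = 0.
Proof.
move=> p1; apply/eqP; apply: contraT => Lj.
have [k Lk] : exists k, (L j.+2)`_k != 0.
  by exists (size (L j.+2)).-1; rewrite -/(lead_coef _) lead_coef_eq0.
have /eqP := euler_natr (L_euler j.+2) Lk.
rewrite p1 invrN invr1 mulrN1 -subr_eq0 -opprB oppr_eq0 opprK -natr1 addrK -natrD.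
by rewrite addnS (negPf (natrS_neq0 char0 _)).
Qed.

End NonTrivial.

Lemma generator_action : L 0 != 0 ->
  exists a b c d, [/\ p != -1 -> c = 0, d = 0 \/ (alpha = p /\ beta = 0)
                   & forall s, F s = Vcoef p a b c d s].
Proof.
move=> L0; have [a [b L0E]] := L0_form L0.
have [c cE c0] : exists2 c, forall i, L i.+1 = if i is 0 then CC c else 0
                   & p != -1 -> c = 0.
  have [p1|p1] := eqVneq p (-1).
    have [c cE] := L1_const L0E p1; exists c => // -[|i] //.
    exact: LSS_eq0 L0E _ p1.
  by exists 0 => // i; rewrite (LS_eq0 L0E i p1); case: i => //; rewrite !polyC0.
have [d dE d0] : exists2 d, W 0 = CC d & d = 0 \/ (alpha = p /\ beta = 0).
  have [W0|/(W_const L0E)[b0 e0 [d dE]]] := eqVneq (W 0) 0.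
    by exists 0; [rewrite W0 !polyC0|left].
  by exists d => //; right; split=> //; apply/eqP; rewrite -subr_eq0 -[alpha]add0r e0.
exists a, b, c, d; split=> // -[[|[|i]]|[|j]] //=; rewrite ?cE //.
exact: WS_eq0 L0E j.
Qed.

End Classification.

(** * Passing between a free module of rank one and its coefficients *)

Section RankOne.
Variables (K : fieldType) (alpha beta p : K).
Variable V : conformalModule (frakB alpha beta p).
Variables (v : V) (phi : V -> {poly K}).
Notation P1 := {poly K}.
Notation P2 := {poly {poly K}}.
Notation P3 := {poly {poly {poly K}}}.
Notation la := ('X%:P : P3).
Notation mu := ('X : P3).
Hypothesis phiK : forall w, phi w *: v = w.
Hypothesis Kphi : forall P : P1, phi (P *: v) = P.

Lemma lcoefZ_lconst (S : comNzRingType) (M : lmodType S) (c : {poly S}) (m : M) n :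
  lcoef (c *: lconst m) n = c`_n *: m.
Proof.
rewrite lcoefZ big_ord_recr /= subnn lcoef_const eqxx big1 ?add0r // => i _.
by rewrite lcoef_const eq_sym subn_eq0 leqNgt ltn_ord scaler0.
Qed.

Lemma phiD x y : phi (x + y) = phi x + phi y.
Proof. by rewrite -{1}[x]phiK -{1}[y]phiK -scalerDl Kphi. Qed.

Lemma phi0 : phi 0 = 0.
Proof. by rewrite -(scale0r v) Kphi. Qed.

Lemma phiZ P x : phi (P *: x) = P * phi x.
Proof. by rewrite -{1}[x]phiK scalerA Kphi. Qed.

Definition action_coef (s : Bgen) : P2 :=
  let f := act (Bvec K s : frakB alpha beta p) v in
  \sum_(k <- msupp f) 'X^k * (phi (lcoef f k))%:P.

Lemma act_gen s :
  act (Bvec K s : frakB alpha beta p) v = action_coef s *: lconst v.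
Proof.
rewrite [LHS]lpolyE /action_coef scaler_suml; apply: eq_bigr => k _.
by rewrite -scalerA -lconstZ phiK.
Qed.

Lemma action_coef_jacobi : jacobi_coefs alpha beta p action_coef.
Proof.
move=> s t; have := act_jacobi (Bvec K s : frakB alpha beta p) (Bvec K t) v.
have sact := act_sesq V.
move=> /JE.
have -> : bracket (Bvec K s : frakB alpha beta p) (Bvec K t)
    = Bcoef alpha beta p s t *: lconst (Bvec K (Bgen_add s t)).
  exact: BbracketU.
rewrite !act_gen !(jac2Z (@dsubrX K) (@dsubrC K) sact).
rewrite (jac3Z (@dsublX K) (@dsublC K) sact) /jac2 /jac3.
rewrite !lsubst_const; last 3 first.
- by move=> *; rewrite (sesq_addl sact) suD.
- by move=> *; rewrite (sesq_addr sact) suD.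
- by move=> *; rewrite (sesq_addr sact) suD.
rewrite !act_gen !suZ /su !(lsubst_const _ (@lconst2D K V)) !scalerA -scalerBl.
(* Both sides of [E] are scalars acting on [v]; freeness of [v] lets the scalars be compared
   coefficient by coefficient in [mu] and [lambda]. *)
move=> E; apply/polyP => k; apply/polyP => l; apply: (can_inj Kphi).
have := congr1 (fun f : lpoly (lpoly V) => lcoef (lcoef f k) l) E.
by rewrite /lconst2 !lcoefZ_lconst.
Qed.

Lemma act_gen_scale s w : act (Bvec K s : frakB alpha beta p) w
  = (dsubr K (phi w) * action_coef s) *: lconst v.
Proof.
rewrite -{1}[w]phiK (sesqZr (@dsubrX K) (@dsubrC K) (act_sesq V)) act_gen.
by rewrite scalerA.
Qed.

Lemma action_coef_nontrivial :
  nontrivial_module V -> ~ (forall s, action_coef s = 0).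
Proof.
move=> [x [w xw]] F0; apply: xw; have sV := act_sesq V.
elim/(@malg_spans K Bgen (inl 0%N)): x => [x y Hx Hy|P x Hx|_ [s ->]].
- by rewrite (sesq_addl sV) Hx Hy addr0.
- by rewrite (sesqZl (@dsublX K) (@dsublC K) sV) Hx scaler0.
by rewrite act_gen_scale F0 mulr0 scale0r.
Qed.

Section Iso.
Variables (a b c d : K).
Hypothesis cP : c = 0 \/ p = -1.
Hypothesis dP : d = 0 \/ (alpha = p /\ beta = 0).

(** The coordinate map [phi] is the isomorphism; by sesquilinearity it suffices to compare the
    actions of the generators [s]. *)
Lemma action_coef_iso : (forall s, action_coef s = Vcoef p a b c d s) ->
  module_iso V (V_gen a b cP dP).
Proof.
move=> E.
have lin : linear (phi : V -> Vcar K) by move=> P x y; rewrite phiD phiZ.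
pose f : {linear V -> Vcar K} :=
  HB.pack (phi : V -> Vcar K) (GRing.isLinear.Build _ _ _ _ (phi : V -> Vcar K) lin).
exists f; split; first by exists (fun P => P *: v) => x; [exact: phiK|exact: Kphi].
have sV := act_sesq V; have sW := Vact_sesq p a b c d.
move=> x w n; rewrite /=.
elim/(@malg_spans K Bgen (inl 0%N)): x n => [x y Hx Hy|P x Hx|_ [s ->]] n.
- by rewrite (sesq_addl sV) (sesq_addl sW) !lcoefD Hx Hy phiD.
- rewrite (sesqZl (@dsublX K) (@dsublC K) sV) (sesqZl (@dsublX K) (@dsublC K) sW).
  rewrite !lcoefZ (big_morph _ phiD phi0).
  by apply: eq_bigr => i _; rewrite Hx phiZ.
rewrite act_gen_scale lcoefZ_lconst Kphi /Vact semilin_extU E.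
by rewrite lcoefZ_lconst; exact: mulr1.
Qed.

End Iso.
End RankOne.

Theorem theorem4p4 (R : realType) (alpha beta p : R[i]) (hp : p <> 0)
    (V : conformalModule (frakB alpha beta p))
    (hfree : free_rank_one V) (hnt : nontrivial_module V) :
  (p <> -1 ->
     ((alpha, beta) <> (p, 0) ->
        exists a b : R[i], module_iso V (V_ab alpha beta p a b)) /\
     (forall h : (alpha, beta) = (p, 0),
        exists a b d : R[i], module_iso V (V_abd h a b d))) /\
  (forall hp1 : p = -1,
     ((alpha, beta) <> (-1, 0) ->
        exists a b c : R[i], module_iso V (V_abc alpha beta hp1 a b c)) /\
     (forall h : (alpha, beta) = (-1, 0),
        exists a b c d : R[i], module_iso V (V_abcd hp1 h a b c d))).
Proof.
have [v [phi Kphi phiK]] := hfree.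
have p0 : p != 0 by exact/eqP.
have J := action_coef_jacobi phiK Kphi.
have L0 : action_coef v phi (inl 0%N) != 0.
  apply/eqP => /(trivial_of_L0 p0 J).
  exact: (action_coef_nontrivial phiK).
have [a [b [c [d [cP dP E]]]]] :=
  generator_action (Num.Theory.pchar_num _) p0 J L0.
(* The proofs of the side conditions stay arbitrary, so that [iso] fits the particular ones inside
   [V_ab], [V_abd], [V_abc] and [V_abcd]. *)
have iso := fun cP dP => action_coef_iso phiK Kphi cP dP E.
have d0 : (alpha, beta) <> (p, 0) -> d = 0.
  by case: dP => // -[-> ->] /(_ erefl).
split=> [/eqP p1|hp1]; [have c0 := cP p1|]; split=> h.
- by move: iso; rewrite c0 (d0 h) => iso; exists a, b; exact: iso.
- by move: iso; rewrite c0 => iso; exists a, b, d; exact: iso.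
- rewrite -hp1 in h; move: iso; rewrite (d0 h) => iso.
  by exists a, b, c; exact: iso.
- by exists a, b, c, d; exact: iso.
Qed.
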